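(* Let $R_q$ be the one-parameter $R$-matrix of type $B_n$, $C_n$ or $D_n$, and let $L_{\varepsilon_1},\dots,L_{\varepsilon_n}$ be algebraically independent invertible transcendental elements. There is a unique injective algebra homomorphism $$\eta_R\colon\widetilde U(R_q)\to\widetilde U'(R_q)\otimes\mathbb K[L_{\varepsilon_1}^{\pm1},\dots,L_{\varepsilon_n}^{\pm1}]$$ such that $$\eta_R(\ell_{ij}^\pm)=\ell_{ij}^\pm\otimes L_{-\varepsilon_i-\varepsilon_j}\qquad\text{for all }1\le i,j\le N,$$ where $L_\mu=L_{\varepsilon_1}^{c_1}L_{\varepsilon_2}^{c_2}\cdots L_{\varepsilon_n}^{c_n}$ for $\mu=\sum_{i=1}^nc_i\varepsilon_i$ with $c_i\in\mathbb Z$.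
   Context: $\mathbb K$ is an algebraically closed field, $q\in\mathbb K$ is transcendental (in particular not a root of unity). Type $B_n$: $N=2n+1$, $i'=2n+2-i$. Types $C_n$ and $D_n$ ($n\ge3$ in type $D_n$): $N=2n$, $i'=2n+1-i$. $\varepsilon_1,\dots,\varepsilon_n$ are the standard weights, $\varepsilon_{i'}=-\varepsilon_i$ for $1\le i\le n$, and $\varepsilon_{n+1}=0$ in type $B_n$. $E_{ij}$ are matrix units in $\mathrm{End}(\mathbb K^N)$; $\tau$ is the flip on $\mathbb K^N\otimes\mathbb K^N$. $R_q=\hat R_q\circ\tau$, where Type $B_n$: $\hat R_q=q^{-2}\sum_{i\ne n+1}E_{ii}\otimes E_{ii}+E_{n+1,n+1}\otimes E_{n+1,n+1}+q^2\sum_{i\ne n+1}E_{ii'}\otimes E_{i'i}+\sum_{j\ne i,i'}E_{ij}\otimes E_{ji}+(q^2-q^{-2})\sum_{i=1}^n(q^{4(n-i)+2}-1)E_{i'i'}\otimes E_{ii}+(q^{-2}-q^2)\sum_{i>j,\,j\ne i'}E_{ii}\otimes E_{jj}+(q^2-q^{-2})\sum_{i<j,\,j\ne i'}t_it_j^{-1}E_{i'j}\otimes E_{ij'}$, with $t_i=q^{2(n-i)+1}$ for $i<n+1$, $t_{n+1}=q$, $t_i=q^{2(n+1-i)+1}$ for $i>n+1$. Type $C_n$: $\hat R_q=q^{-1}\sum_iE_{ii}\otimes E_{ii}+q\sum_iE_{ii'}\otimes E_{i'i}+\sum_{j\ne i,i'}E_{ij}\otimes E_{ji}+(q^{-1}-q)\sum_{i=1}^n(q^{2(n+1-i)}+1)E_{i'i'}\otimes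 E_{ii}+(q^{-1}-q)\sum_{i>j,\,j\ne i'}E_{ii}\otimes E_{jj}+(q-q^{-1})\sum_{i<j,\,j\ne i'}t_it_j^{-1}E_{i'j}\otimes E_{ij'}$, with $t_i=q^{n+1-i}$ for $i\le n$, $t_i=-q^{n-i}$ for $i>n$. Type $D_n$: $\hat R_q=q^{-1}\sum_iE_{ii}\otimes E_{ii}+q\sum_iE_{ii'}\otimes E_{i'i}+\sum_{j\ne i,i'}E_{ij}\otimes E_{ji}+(q^{-1}-q)\sum_{i=1}^n(1-q^{2(n-i)})E_{i'i'}\otimes E_{ii}+(q^{-1}-q)\sum_{i>j,\,j\ne i'}E_{ii}\otimes E_{jj}+(q-q^{-1})\sum_{i<j,\,j\ne i'}t_it_j^{-1}E_{i'j}\otimes E_{ij'}$, with $t_i=q^{n-i}$ for $i\le n$, $t_i=q^{n+1-i}$ for $i>n$. (Unless indicated, indices run over $1,\dots,N$.) $U(R)$ is the $\mathbb K$-algebra generated by $\ell_{ji}^+,\ell_{ij}^-$ ($1\le i\le j\le N$) and $(\ell_{ii}^\pm)^{-1}$, with relations $RL_1^\pm L_2^\pm=L_2^\pm L_1^\pm R$, $RL_1^+L_2^-=L_2^-L_1^+R$, $\ell_{ii}^\pm(\ell_{ii}^\pm)^{-1}=(\ell_{ii}^\pm)^{-1}\ell_{ii}^\pm=1$, where $L_1^\pm=\sum E_{ij}\otimes1\otimes\ell_{ij}^\pm$, $L_2^\pm=\sum1\otimes E_{ij}\otimes\ell^\pm_{ij}$ and $\ell_{ij}^+=0=\ell_{ji}^-$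 for $i<j$. For an $N\times N$ matrix $A=(a_{ij})$ put $A^{\mathsf t'}=(a_{j'i'})$. $C_q=\mathrm{diag}(c_1,\dots,c_N)$ with: type $B_n$: $c_i=q^{2\rho_i}$, $(\rho_i)=(n-\frac12,n-\frac32,\dots,\frac12,\frac12,-\frac12,\dots,-n+\frac12)$; type $C_n$: $c_i=\sigma_iq^{\rho_i}$, $(\rho_i)=(n,n-1,\dots,1,-1,\dots,-n)$, $\sigma_i=1$ for $i\le n$ and $-1$ for $i>n$; type $D_n$: $c_i=q^{\rho_i}$, $(\rho_i)=(n-1,\dots,1,0,0,-1,\dots,-n+1)$. $\widetilde U(R_q)$ is the quotient of $U(R_q)$ by the ideal generated by the entries of $L^\pm C_q(L^\pm)^{\mathsf t'}C_q^{-1}-I$ and, in type $B_n$, additionally by $\ell_{n+1,n+1}^\pm-1$. $\widetilde U'(R_q)$ is the quotient of $\widetilde U(R_q)$ by the further relations $(\ell_{ii}^\pm)^{-1}=\ell_{ii}^\mp$, $1\le i\le N$. *)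

(* Defs.v *)
From HB Require Import structures.
From mathcomp Require Import all_boot all_order all_algebra.
From mathcomp Require Import finmap boolp.
From mathcomp.multinomials Require Import monalg.
From mathcomp.real_closed Require Import mxtens.

Set Implicit Arguments.
Unset Strict Implicit.
Unset Printing Implicit Defensive.

Import GRing.Theory.

Local Open Scope ring_scope.
Local Open Scope quotient_scope.

(* Associative unital K-algebras, as rings with a ring morphism from K to the
   centre, so that [k *: x] is [pzscalar k * x].  The library's algType excludes
   the zero algebra, which an algebra given by generators and relations may be
   a priori. *)
HB.mixin Record isPzAlgebra (K : pzRingType) A of GRing.PzRing A := {
  pzscalar : K -> A;
  pzscalar_is_zmod_morphism : zmod_morphism pzscalar;
  pzscalar_is_monoid_morphism : monoid_morphism pzscalar;
  pzscalar_comm : forall (k : K) (x : A), pzscalar k * x = x * pzscalar k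
}.

#[short(type="pzAlgType")]
HB.structure Definition PzAlgebra (K : pzRingType) :=
  {A of isPzAlgebra K A & GRing.PzRing A}.

Definition alg_hom (K : pzRingType) (A B : pzAlgType K) (f : A -> B) : Prop :=
  [/\ zmod_morphism f, monoid_morphism f & forall k : K, f (pzscalar k) = pzscalar k].

(* {malg K[M]} is the free K-module on M.  The ring structure of the library
   on it requires M to have no nontrivial unit, which rules out groups. *)
Definition monoid_alg (K : fieldType) (M : monoidType) := {malg K[M]}.

Section MonoidAlg.
Variables (K : fieldType) (M : monoidType).

HB.instance Definition _ := GRing.Zmodule.on (monoid_alg K M).

Implicit Types g h : monoid_alg K M.

Definition basis_elt (m : M) : monoid_alg K M := << m >>.

Definition monoid_alg_one : monoid_alg K M := << 1%g >>.

Definition monoid_alg_mul g h : monoid_alg K M :=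
  \sum_(k <- msupp g) \sum_(l <- msupp h) << g@_k * h@_l *g (k * l)%g >>.

Local Notation mmul := monoid_alg_mul.

Lemma monoid_alg_mulw (d e : {fset M}) g h :
  (msupp g `<=` d)%fset -> (msupp h `<=` e)%fset ->
  mmul g h = \sum_(k <- d) \sum_(l <- e) << g@_k * h@_l *g (k * l)%g >>.
Proof.
move=> gd he; rewrite /mmul (big_fset_incl _ gd) /=.
  apply/eq_bigr=> k _; apply/big_fset_incl => // l _ /mcoeff_outdom ->.
  by rewrite mulr0 monalgU0.
move=> k _ /mcoeff_outdom gk.
by rewrite big1 => // l _; rewrite gk mul0r monalgU0.
Qed.

Lemma monoid_alg_mulDl : left_distributive mmul +%R.
Proof.
move=> g1 g2 h; set d := (msupp g1 `|` msupp g2)%fset.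
rewrite (@monoid_alg_mulw d (msupp h)) ?msuppD_le ?fsubset_refl //.
rewrite (@monoid_alg_mulw d (msupp h) g1) ?fsubsetUl ?fsubset_refl //.
rewrite (@monoid_alg_mulw d (msupp h) g2) ?fsubsetUr ?fsubset_refl //.
rewrite -big_split /=; apply/eq_bigr=> k _.
rewrite -big_split /=; apply/eq_bigr=> l _.
by rewrite mcoeffD mulrDl monalgUD.
Qed.

Lemma monoid_alg_mulDr : right_distributive mmul +%R.
Proof.
move=> h g1 g2; set d := (msupp g1 `|` msupp g2)%fset.
rewrite (@monoid_alg_mulw (msupp h) d) ?msuppD_le ?fsubset_refl //.
rewrite (@monoid_alg_mulw (msupp h) d h g1) ?fsubsetUl ?fsubset_refl //.
rewrite (@monoid_alg_mulw (msupp h) d h g2) ?fsubsetUr ?fsubset_refl //.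
rewrite -big_split /=; apply/eq_bigr=> k _.
rewrite -big_split /=; apply/eq_bigr=> l _.
by rewrite mcoeffD mulrDr monalgUD.
Qed.

Lemma monoid_alg_mulUU (c d : K) (k l : M) :
  mmul << c *g k >> << d *g l >> = << c * d *g (k * l)%g >>.
Proof.
by rewrite (monoid_alg_mulw msuppU_le msuppU_le) !big_seq_fset1 !mcoeffUU.
Qed.

Lemma monoid_alg_mul0g : left_zero 0 mmul.
Proof. by move=> g; apply: (addIr (mmul 0 g)); rewrite -monoid_alg_mulDl !add0r. Qed.

Lemma monoid_alg_mulg0 : right_zero 0 mmul.
Proof. by move=> g; apply: (addIr (mmul g 0)); rewrite -monoid_alg_mulDr !add0r. Qed.

Lemma monoid_alg_ind (P : monoid_alg K M -> Prop) :
  P 0 -> (forall g h, P g -> P h -> P (g + h)) ->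
  (forall c k, P << c *g k >>) -> forall g, P g.
Proof.
by move=> P0 PD PU g; rewrite [g]monalgE; apply: big_ind => // k _; apply: PU.
Qed.

Lemma monoid_alg_mulA : associative mmul.
Proof.
move=> g h l; elim/monoid_alg_ind: g.
- by rewrite !monoid_alg_mul0g.
- by move=> g1 g2 e1 e2; rewrite !monoid_alg_mulDl e1 e2.
move=> c i; elim/monoid_alg_ind: h.
- by rewrite monoid_alg_mulg0 !monoid_alg_mul0g monoid_alg_mulg0.
- by move=> h1 h2 e1 e2; rewrite !(monoid_alg_mulDl, monoid_alg_mulDr) e1 e2.
move=> d j; elim/monoid_alg_ind: l.
- by rewrite !monoid_alg_mulg0.
- by move=> l1 l2 e1 e2; rewrite !monoid_alg_mulDr e1 e2.
by move=> e k; rewrite !monoid_alg_mulUU mulrA mulgA.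
Qed.

Lemma monoid_alg_mul1 : left_id monoid_alg_one mmul.
Proof.
elim/monoid_alg_ind=> [|g h eg eh|c k]; first exact: monoid_alg_mulg0.
  by rewrite monoid_alg_mulDr eg eh.
by rewrite monoid_alg_mulUU mul1r mul1g.
Qed.

Lemma monoid_alg_mulr1 : right_id monoid_alg_one mmul.
Proof.
elim/monoid_alg_ind=> [|g h eg eh|c k]; first exact: monoid_alg_mul0g.
  by rewrite monoid_alg_mulDl eg eh.
by rewrite monoid_alg_mulUU mulr1 mulg1.
Qed.

HB.instance Definition _ := GRing.Zmodule_isPzRing.Build (monoid_alg K M)
  monoid_alg_mulA monoid_alg_mul1 monoid_alg_mulr1
  monoid_alg_mulDl monoid_alg_mulDr.

Definition monoid_alg_scalar (c : K) : monoid_alg K M := << c *g 1%g >>.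

Lemma monoid_alg_scalar_zmod : zmod_morphism monoid_alg_scalar.
Proof. by move=> c d; apply: monalgUB. Qed.

Lemma monoid_alg_scalar_monoid : monoid_morphism monoid_alg_scalar.
Proof.
split=> // c d.
by rewrite -[RHS]/(mmul _ _) monoid_alg_mulUU mul1g.
Qed.

Lemma monoid_alg_scalar_comm c g :
  monoid_alg_scalar c * g = g * monoid_alg_scalar c.
Proof.
rewrite -[LHS]/(mmul _ _) -[RHS]/(mmul _ _).
elim/monoid_alg_ind: g => [|g h eg eh|d k].
- by rewrite monoid_alg_mulg0 monoid_alg_mul0g.
- by rewrite monoid_alg_mulDl monoid_alg_mulDr eg eh.
by rewrite !monoid_alg_mulUU mulrC mul1g mulg1.
Qed.

HB.instance Definition _ := isPzAlgebra.Build K (monoid_alg K M)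
  monoid_alg_scalar_zmod monoid_alg_scalar_monoid monoid_alg_scalar_comm.

Lemma basis_elt1 : basis_elt 1%g = 1. Proof. by []. Qed.

Lemma basis_eltM (k l : M) : basis_elt (k * l)%g = basis_elt k * basis_elt l.
Proof. by rewrite /basis_elt -[RHS]/(mmul _ _) monoid_alg_mulUU mulr1. Qed.

End MonoidAlg.

Inductive gen_ideal (A : pzRingType) (S : A -> Prop) : A -> Prop :=
| gen_ideal_gen x : S x -> gen_ideal S x
| gen_ideal0 : gen_ideal S 0
| gen_idealD x y : gen_ideal S x -> gen_ideal S y -> gen_ideal S (x + y)
| gen_idealMl a x : gen_ideal S x -> gen_ideal S (a * x)
| gen_idealMr a x : gen_ideal S x -> gen_ideal S (x * a).

Definition gen_ideal_pred (A : pzRingType) (S : A -> Prop) : A -> bool :=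
  fun x => `[< gen_ideal S x >].

Lemma gen_ideal_zmod_closed (A : pzRingType) (S : A -> Prop) :
  zmod_closed (gen_ideal_pred S).
Proof.
split=> [|x y /asboolP Sx /asboolP Sy]; apply/asboolP; first exact: gen_ideal0.
by apply: gen_idealD => //; rewrite -mulN1r; apply: gen_idealMl.
Qed.

HB.instance Definition _ (A : pzRingType) (S : A -> Prop) :=
  GRing.isZmodClosed.Build A (gen_ideal_pred S) (gen_ideal_zmod_closed S).

Definition gen_ideal_zmodClosed (A : pzRingType) (S : A -> Prop) :
  zmodClosed A := GRing.ZmodClosed.clone A (gen_ideal_pred S) _.

Definition alg_quot (K : fieldType) (A : pzAlgType K) (S : A -> Prop) : Type :=
  Quotient.quot (gen_ideal_zmodClosed S).

Section AlgQuot.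
Variables (K : fieldType) (A : pzAlgType K) (S : A -> Prop).

Local Notation Q := (alg_quot S).

HB.instance Definition _ := GRing.Zmodule.on Q.
HB.instance Definition _ := EqQuotient.on Q.

Definition to_quot (x : A) : Q := \pi x.

Lemma to_quot_eq x y : (to_quot x = to_quot y) <-> gen_ideal S (x - y).
Proof.
rewrite /to_quot; split=> [/eqP|Sxy].
  by rewrite -Quotient.idealrBE => /asboolP.
by apply/eqP; rewrite -Quotient.idealrBE; apply/asboolP.
Qed.

Lemma to_quot_repr (x : Q) : to_quot (repr x) = x.
Proof. exact: reprK. Qed.

Lemma to_quot_reprB x : gen_ideal S (repr (to_quot x) - x).
Proof. by apply/to_quot_eq; rewrite to_quot_repr. Qed.

Lemma to_quotD : {morph to_quot : x y / x + y}.
Proof. by move=> x y; rewrite /to_quot !piE. Qed.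

Definition alg_quot_mul (x y : Q) : Q := to_quot (repr x * repr y).

Lemma to_quot_mul x y : alg_quot_mul (to_quot x) (to_quot y) = to_quot (x * y).
Proof.
apply/to_quot_eq; set x' := repr _; set y' := repr _.
have -> : x' * y' - x * y = (x' - x) * y' + x * (y' - y).
  by rewrite mulrBl mulrBr addrA subrK.
by apply: gen_idealD; [apply: gen_idealMr | apply: gen_idealMl];
  apply: to_quot_reprB.
Qed.

Lemma alg_quot_mulA : associative alg_quot_mul.
Proof.
move=> x y z; rewrite -[x]to_quot_repr -[y]to_quot_repr -[z]to_quot_repr.
by rewrite !to_quot_mul mulrA.
Qed.

Lemma alg_quot_mul1 : left_id (to_quot 1) alg_quot_mul.
Proof. by move=> x; rewrite -[x]to_quot_repr to_quot_mul mul1r. Qed.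

Lemma alg_quot_mulr1 : right_id (to_quot 1) alg_quot_mul.
Proof. by move=> x; rewrite -[x]to_quot_repr to_quot_mul mulr1. Qed.

Lemma alg_quot_mulDl : left_distributive alg_quot_mul +%R.
Proof.
move=> x y z; rewrite -[x]to_quot_repr -[y]to_quot_repr -[z]to_quot_repr.
by rewrite -to_quotD !to_quot_mul -to_quotD mulrDl.
Qed.

Lemma alg_quot_mulDr : right_distributive alg_quot_mul +%R.
Proof.
move=> x y z; rewrite -[x]to_quot_repr -[y]to_quot_repr -[z]to_quot_repr.
by rewrite -to_quotD !to_quot_mul -to_quotD mulrDr.
Qed.

HB.instance Definition _ := GRing.Zmodule_isPzRing.Build Q
  alg_quot_mulA alg_quot_mul1 alg_quot_mulr1 alg_quot_mulDl alg_quot_mulDr.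

Lemma to_quotM : {morph to_quot : x y / x * y}.
Proof. by move=> x y; rewrite -to_quot_mul. Qed.

Lemma to_quotB : {morph to_quot : x y / x - y}.
Proof. by move=> x y; rewrite /to_quot !piE. Qed.

Definition alg_quot_scalar (k : K) : Q := to_quot (pzscalar k).

Lemma alg_quot_scalar_zmod : zmod_morphism alg_quot_scalar.
Proof.
by move=> k l; rewrite /alg_quot_scalar pzscalar_is_zmod_morphism to_quotB.
Qed.

Lemma alg_quot_scalar_monoid : monoid_morphism alg_quot_scalar.
Proof.
have [s1 sM] := @pzscalar_is_monoid_morphism K A.
by split=> [|k l]; rewrite /alg_quot_scalar ?s1 // sM to_quotM.
Qed.

Lemma alg_quot_scalar_comm k (x : Q) :
  alg_quot_scalar k * x = x * alg_quot_scalar k.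
Proof. by rewrite -[x]to_quot_repr -!to_quotM pzscalar_comm. Qed.

HB.instance Definition _ := isPzAlgebra.Build K Q
  alg_quot_scalar_zmod alg_quot_scalar_monoid alg_quot_scalar_comm.

Lemma to_quot_alg_hom : alg_hom to_quot.
Proof. by split=> //; [exact: to_quotB | split=> //; exact: to_quotM]. Qed.

End AlgQuot.

Definition word (X : choiceType) := seq X.

HB.instance Definition _ (X : choiceType) := Choice.on (word X).
HB.instance Definition _ (X : choiceType) := isMonoid.Build (word X)
  (@catA X) (@cat0s X) (@cats0 X).

Definition free_alg (K : fieldType) (X : choiceType) := monoid_alg K (word X).

HB.instance Definition _ (K : fieldType) (X : choiceType) :=
  PzAlgebra.on (free_alg K X).

Definition free_gen (K : fieldType) (X : choiceType) (x : X) : free_alg K X :=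
  basis_elt K ([:: x] : word X).

Definition tensor_basis (A B : Type) : Type := A * B.

HB.instance Definition _ (A B : choiceType) := Choice.on (tensor_basis A B).

Section TensorBasis.
Variables A B : pzRingType.
Local Notation T := (tensor_basis A B).

Definition tensor_basis_mul (x y : T) : T := (x.1 * y.1, x.2 * y.2).
Definition tensor_basis_one : T := (1, 1).

Lemma tensor_basis_mulA : associative tensor_basis_mul.
Proof. by move=> x y z; rewrite /tensor_basis_mul !mulrA. Qed.

Lemma tensor_basis_mul1 : left_id tensor_basis_one tensor_basis_mul.
Proof. by case=> a b; rewrite /tensor_basis_mul !mul1r. Qed.

Lemma tensor_basis_mulr1 : right_id tensor_basis_one tensor_basis_mul.
Proof. by case=> a b; rewrite /tensor_basis_mul !mulr1. Qed.

HB.instance Definition _ := isMonoid.Build T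
  tensor_basis_mulA tensor_basis_mul1 tensor_basis_mulr1.

End TensorBasis.

Section Tensor.
Variables (K : fieldType) (A B : pzAlgType K).

(* The free K-module on A x B, with (a, b) (a', b') = (a a', b b').  The span
   of the bilinearity relators is a two-sided ideal of it, so that the quotient
   [tensor] below has the K-module A (x)_K B as underlying module. *)
Definition pre_tensor := monoid_alg K (tensor_basis A B).

Definition pre_pure (a : A) (b : B) : pre_tensor :=
  basis_elt K ((a, b) : tensor_basis A B).

Variant bilinear_relator : pre_tensor -> Prop :=
| TensorDl a a' b :
    bilinear_relator (pre_pure (a + a') b - (pre_pure a b + pre_pure a' b))
| TensorDr a b b' :
    bilinear_relator (pre_pure a (b + b') - (pre_pure a b + pre_pure a b'))
| TensorZl k a b :
    bilinear_relator (pre_pure (pzscalar k * a) b - pzscalar k * pre_pure a b)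
| TensorZr k a b :
    bilinear_relator (pre_pure a (pzscalar k * b) - pzscalar k * pre_pure a b).

Definition tensor := alg_quot bilinear_relator.

HB.instance Definition _ := PzAlgebra.on tensor.

Definition pure_tensor (a : A) (b : B) : tensor :=
  to_quot bilinear_relator (pre_pure a b).

Lemma pure_tensorM a a' b b' :
  pure_tensor a b * pure_tensor a' b' = pure_tensor (a * a') (b * b').
Proof. by rewrite /pure_tensor -to_quotM /pre_pure -basis_eltM. Qed.

Lemma pure_tensor1 : pure_tensor 1 1 = 1. Proof. by []. Qed.

End Tensor.

(* K[L_1^+-1, ..., L_n^+-1] is the group algebra of Z^n; the monomial L_mu is
   the basis element attached to the exponent vector mu. *)
Definition laurent (K : fieldType) (n : nat) :=
  monoid_alg K (Algebra.to_multiplicative 'rV[int]_n).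

HB.instance Definition _ (K : fieldType) (n : nat) :=
  PzAlgebra.on (laurent K n).

Definition laurent_monomial (K : fieldType) (n : nat) (mu : 'rV[int]_n) :
  laurent K n := basis_elt K (mu : Algebra.to_multiplicative 'rV[int]_n).

Lemma laurent_monomial0 (K : fieldType) (n : nat) :
  laurent_monomial K (0 : 'rV[int]_n) = 1.
Proof. exact: basis_elt1. Qed.

Lemma laurent_monomialD (K : fieldType) (n : nat) (mu nu : 'rV[int]_n) :
  laurent_monomial K (mu + nu) = laurent_monomial K mu * laurent_monomial K nu.
Proof.
exact: (basis_eltM K (mu : Algebra.to_multiplicative 'rV[int]_n)
  (nu : Algebra.to_multiplicative 'rV[int]_n)).
Qed.

Inductive cartan_type := TypeB | TypeC | TypeD.

Definition rank_ok (X : cartan_type) (n : nat) : bool :=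
  match X with TypeD => 2 < n | _ => 0 < n end%N.

Definition rdim (X : cartan_type) (n : nat) : nat :=
  match X with TypeB => n.*2.+1 | _ => n.*2 end%N.

(* Row and column indices 1, ..., N are represented by 'I_N, counted from 0;
   [index1 i] is the index counted from 1, and i' = N + 1 - i is [rev_ord i]. *)
Definition index1 (N : nat) (i : 'I_N) : int := i.+1%:Z.

(* epsilon_i for 1 <= i <= N, as a vector of coordinates on epsilon_1, ...,
   epsilon_n; it is 0 for the middle index of type B, where i = i' = n + 1. *)
Definition eps (X : cartan_type) (n : nat) (i : 'I_(rdim X n)) : 'rV[int]_n :=
  \row_(k < n) ((i == k :> nat)%:Z - (rev_ord i == k :> nat)%:Z).

Section RMatrix.
Variable K : fieldType.

Section Indices.
Variables (N n : nat).
Local Notation E := (@delta_mx K N N).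
Local Notation "i ^'" := (rev_ord i).

Definition coefB_t (q : K) (i : 'I_N) : K :=
  if (i < n)%N then q ^ (2 * (n%:Z - index1 i) + 1)
  else if i == n :> nat then q
  else q ^ (2 * (n%:Z + 1 - index1 i) + 1).

Definition coefC_t (q : K) (i : 'I_N) : K :=
  if (i < n)%N then q ^ (n%:Z + 1 - index1 i) else - q ^ (n%:Z - index1 i).

Definition coefD_t (q : K) (i : 'I_N) : K :=
  if (i < n)%N then q ^ (n%:Z - index1 i) else q ^ (n%:Z + 1 - index1 i).

Definition hatRB (q : K) : 'M[K]_(N * N) :=
  let t := coefB_t q in
  q ^- 2 *: (\sum_(i : 'I_N | i != n :> nat) E i i *t E i i)
  + \sum_(i : 'I_N | i == n :> nat) E i i *t E i i
  + q ^+ 2 *: (\sum_(i : 'I_N | i != n :> nat) E i i^' *t E i^' i)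
  + \sum_(i : 'I_N) \sum_(j : 'I_N | (j != i) && (j != i^')) E i j *t E j i
  + (q ^+ 2 - q ^- 2) *:
      (\sum_(i : 'I_N | (i < n)%N)
        (q ^ (4 * (n%:Z - index1 i) + 2) - 1) *: (E i^' i^' *t E i i))
  + (q ^- 2 - q ^+ 2) *:
      (\sum_(i : 'I_N) \sum_(j : 'I_N | (j < i)%N && (j != i^')) E i i *t E j j)
  + (q ^+ 2 - q ^- 2) *:
      (\sum_(i : 'I_N) \sum_(j : 'I_N | (i < j)%N && (j != i^'))
        (t i / t j) *: (E i^' j *t E i j^')).

Definition hatRC (q : K) : 'M[K]_(N * N) :=
  let t := coefC_t q in
  q^-1 *: (\sum_(i : 'I_N) E i i *t E i i)
  + q *: (\sum_(i : 'I_N) E i i^' *t E i^' i)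
  + \sum_(i : 'I_N) \sum_(j : 'I_N | (j != i) && (j != i^')) E i j *t E j i
  + (q^-1 - q) *:
      (\sum_(i : 'I_N | (i < n)%N)
        (q ^ (2 * (n%:Z + 1 - index1 i)) + 1) *: (E i^' i^' *t E i i))
  + (q^-1 - q) *:
      (\sum_(i : 'I_N) \sum_(j : 'I_N | (j < i)%N && (j != i^')) E i i *t E j j)
  + (q - q^-1) *:
      (\sum_(i : 'I_N) \sum_(j : 'I_N | (i < j)%N && (j != i^'))
        (t i / t j) *: (E i^' j *t E i j^')).

Definition hatRD (q : K) : 'M[K]_(N * N) :=
  let t := coefD_t q in
  q^-1 *: (\sum_(i : 'I_N) E i i *t E i i)
  + q *: (\sum_(i : 'I_N) E i i^' *t E i^' i)
  + \sum_(i : 'I_N) \sum_(j : 'I_N | (j != i) && (j != i^')) E i j *t E j i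
  + (q^-1 - q) *:
      (\sum_(i : 'I_N | (i < n)%N)
        (1 - q ^ (2 * (n%:Z - index1 i))) *: (E i^' i^' *t E i i))
  + (q^-1 - q) *:
      (\sum_(i : 'I_N) \sum_(j : 'I_N | (j < i)%N && (j != i^')) E i i *t E j j)
  + (q - q^-1) *:
      (\sum_(i : 'I_N) \sum_(j : 'I_N | (i < j)%N && (j != i^'))
        (t i / t j) *: (E i^' j *t E i j^')).

Definition flip_mx : 'M[K]_(N * N) := \sum_(i < N) \sum_(j < N) E i j *t E j i.

(* c_i = q^(2 rho_i) with 2 rho = (2n-1, ..., 3, 1, 1, -1, ..., -2n+1) *)
Definition coefB_c (q : K) (i : 'I_N) : K :=
  q ^ (if (i < n)%N then 2 * (n%:Z - index1 i) + 1
       else if i == n :> nat then 1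
       else 2 * (n%:Z + 1 - index1 i) + 1).

(* c_i = sigma_i q^(rho_i) with rho = (n, ..., 1, -1, ..., -n) *)
Definition coefC_c (q : K) (i : 'I_N) : K :=
  (if (i < n)%N then 1 else -1) *
  q ^ (if (i < n)%N then n%:Z + 1 - index1 i else n%:Z - index1 i).

(* c_i = q^(rho_i) with rho = (n-1, ..., 1, 0, 0, -1, ..., -n+1) *)
Definition coefD_c (q : K) (i : 'I_N) : K :=
  q ^ (if (i < n)%N then n%:Z - index1 i else n%:Z + 1 - index1 i).

End Indices.

Definition Rq (X : cartan_type) (n : nat) (q : K) :
    'M[K]_(rdim X n * rdim X n) :=
  match X with
  | TypeB => @hatRB (rdim X n) n q
  | TypeC => @hatRC (rdim X n) n q
  | TypeD => @hatRD (rdim X n) n q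
  end *m flip_mx (rdim X n).

Definition Cq (X : cartan_type) (n : nat) (q : K) : 'M[K]_(rdim X n) :=
  diag_mx (\row_i match X with
                  | TypeB => @coefB_c (rdim X n) n q i
                  | TypeC => @coefC_c (rdim X n) n q i
                  | TypeD => @coefD_c (rdim X n) n q i
                  end).

End RMatrix.

Definition scal_mx (K : fieldType) (A : pzAlgType K) (m n : nat)
  (M : 'M[K]_(m, n)) : 'M[A]_(m, n) := map_mx pzscalar M.

Definition anti_tr (A : Type) (N : nat) (M : 'M[A]_N) : 'M[A]_N :=
  \matrix_(i, j) M (rev_ord j) (rev_ord i).

Definition is_entry (A : Type) (m n : nat) (M : 'M[A]_(m, n)) (x : A) : Prop :=
  exists i j, x = M i j.

(* Signs are booleans: [true] is +.  L^+ is lower and L^- upper triangular. *)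
Definition ell_support (N : nat) (x : bool * 'I_N * 'I_N) : bool :=
  let: (s, i, j) := x in if s then (j <= i)%N else (i <= j)%N.

(* [inl (s, i, j)] is l_ij^s, and [inr (s, i)] is (l_ii^s)^-1. *)
Definition ell_gen (N : nat) : choiceType :=
  ({x : bool * 'I_N * 'I_N | ell_support x} + bool * 'I_N)%type.

Section RTT.
Variables (K : fieldType) (N : nat).
Local Notation F := (free_alg K (ell_gen N)).

Definition free_L (s : bool) : 'M[F]_N :=
  \matrix_(i, j)
    if insub (s, i, j) is Some x then free_gen K (inl x : ell_gen N) else 0.

Definition free_inv (s : bool) (i : 'I_N) : F :=
  free_gen K (inr (s, i) : ell_gen N).

Variable R : 'M[K]_(N * N).

Definition RLL (s s' : bool) : 'M[F]_(N * N) :=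
  let L1 := free_L s *t 1%:M in
  let L2 := 1%:M *t free_L s' in
  scal_mx F R *m L1 *m L2 - L2 *m L1 *m scal_mx F R.

Variant U_relator : F -> Prop :=
| U_RLL_same s x : is_entry (RLL s s) x -> U_relator x
| U_RLL_mixed x : is_entry (RLL true false) x -> U_relator x
| U_mulV s i : U_relator (free_L s i i * free_inv s i - 1)
| U_mulVl s i : U_relator (free_inv s i * free_L s i i - 1).

Definition UR := alg_quot U_relator.

HB.instance Definition _ := PzAlgebra.on UR.

Definition UR_L (s : bool) : 'M[UR]_N := map_mx (to_quot U_relator) (free_L s).
Definition UR_inv (s : bool) (i : 'I_N) : UR := to_quot U_relator (free_inv s i).

End RTT.

Section TildeU.
Variables (K : fieldType) (X : cartan_type) (n : nat) (q : K).
Local Notation N := (rdim X n).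
Local Notation U := (UR (Rq X n q)).

Definition orth_mx (s : bool) : 'M[U]_N :=
  let L := UR_L (Rq X n q) s in
  L *m scal_mx U (Cq X n q) *m anti_tr L *m scal_mx U (invmx (Cq X n q)) - 1%:M.

Variant tU_relator : U -> Prop :=
| tU_orth s x : is_entry (orth_mx s) x -> tU_relator x
| tU_mid s (i : 'I_N) : X = TypeB -> i = n :> nat ->
    tU_relator (UR_L (Rq X n q) s i i - 1).

Definition tU := alg_quot tU_relator.

HB.instance Definition _ := PzAlgebra.on tU.

Definition tU_L (s : bool) : 'M[tU]_N :=
  map_mx (to_quot tU_relator) (UR_L (Rq X n q) s).
Definition tU_inv (s : bool) (i : 'I_N) : tU :=
  to_quot tU_relator (UR_inv (Rq X n q) s i).

Variant tU'_relator : tU -> Prop :=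
| tU'_inv s i : tU'_relator (tU_inv s i - tU_L (~~ s) i i).

Definition tU' := alg_quot tU'_relator.

HB.instance Definition _ := PzAlgebra.on tU'.

Definition tU'_L (s : bool) : 'M[tU']_N := map_mx (to_quot tU'_relator) (tU_L s).

End TildeU.

(* Transcendental over the prime subfield of K: clearing denominators, it is
   enough to consider the polynomials which are images of integer ones. *)
Definition transcendental (K : fieldType) (q : K) : Prop :=
  forall p : {poly int},
    map_poly intr p != 0 :> {poly K} -> ~~ root (map_poly intr p) q.

(* Main.v *)
(** Write z_i = l_ii^+ l_ii^-.  The matrix R_q is diagonal plus a part that is
    strictly triangular and preserves weights.  As L^+ and L^- are triangular
    too, the entries of the RTT relations that involve l_ii^+ or l_ii^- reduce
    to q-commutation, with factors that cancel in z_i: the z_i are central, and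
    the orthogonality relations give z_i z_i' = 1.

    By weight preservation l_ij |-> f(l_ij) (x) L_(-eps_i-eps_j) is a
    homomorphism for every homomorphism f from U~: the identity gives a
    grading delta of U~, the projection to U~' gives eta_R.  For injectivity,
    take for each weight mu the linear map U~ (x) K[L] -> U~ sending
    a (x) L_nu to a z^((mu+nu)/4), or to 0 if 4 does not divide mu + nu.  It is
    unchanged by multiplication with z_i (x) L_(-4 eps_i), so its composite
    with delta factors through U~'.  These composites p_mu assemble into
    a (x) L_nu |-> p_(-nu)(a), a left inverse of eta_R. *)

From HB Require Import structures.
Require Import Defs.
From mathcomp Require Import all_boot all_order all_algebra.
From mathcomp Require Import finmap boolp zify.
From mathcomp.multinomials Require Import monalg.
From mathcomp.real_closed Require Import mxtens.

Set Implicit Arguments.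
Unset Strict Implicit.
Unset Printing Implicit Defensive.

Import GRing.Theory.

Local Open Scope ring_scope.

(** * Homomorphisms of algebras, quotients and tensor products *)

Section ZmodMorphism.
Variables (U V : zmodType) (f : U -> V).
Hypothesis fB : zmod_morphism f.

Lemma zmod_morphism_sum (I : Type) (r : seq I) (P : pred I) (F : I -> U) :
  f (\sum_(i <- r | P i) F i) = \sum_(i <- r | P i) f (F i).
Proof.
pose fA := GRing.isZmodMorphism.Build U V f fB.
pose g : {additive U -> V} := HB.pack f fA.
exact: (raddf_sum g).
Qed.

Lemma zmod_morphism0 : f 0 = 0.
Proof. by rewrite -(subrr 0) fB subrr. Qed.

Lemma zmod_morphismD : {morph f : x y / x + y}.
Proof.
by move=> x y; rewrite -[y in LHS]opprK fB -(sub0r y) fB zmod_morphism0 sub0r opprK.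
Qed.

End ZmodMorphism.

Section AlgHom.
Variables (K : fieldType) (A B : pzAlgType K) (f : A -> B).
Hypothesis hf : alg_hom f.

Lemma alg_homB : zmod_morphism f. Proof. by case: hf. Qed.
Lemma alg_homD : {morph f : x y / x + y}. Proof. exact: zmod_morphismD alg_homB. Qed.
Lemma alg_hom0 : f 0 = 0. Proof. exact: zmod_morphism0 alg_homB. Qed.
Lemma alg_hom1 : f 1 = 1. Proof. by case: hf => _ [? _]. Qed.
Lemma alg_homM : {morph f : x y / x * y}. Proof. by case: hf => _ [_ ?]. Qed.
Lemma alg_hom_scalar k : f (pzscalar k) = pzscalar k. Proof. by case: hf. Qed.

Lemma alg_hom_ideal (S : A -> Prop) x :
  (forall y, S y -> f y = 0) -> gen_ideal S x -> f x = 0.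
Proof.
move=> fS; elim=> {x} [x /fS //||x y _ fx _ fy|a x _ fx|a x _ fx].
- exact: alg_hom0.
- by rewrite alg_homD fx fy addr0.
- by rewrite alg_homM fx mulr0.
- by rewrite alg_homM fx mul0r.
Qed.

End AlgHom.

Lemma alg_hom_id (K : fieldType) (A : pzAlgType K) : alg_hom (@id A).
Proof. by []. Qed.

Lemma alg_hom_comp (K : fieldType) (A B C : pzAlgType K) (g : B -> C) (f : A -> B) :
  alg_hom g -> alg_hom f -> alg_hom (g \o f).
Proof.
move=> hg hf; split=> [x y||k] /=.
- by rewrite (alg_homB hf) (alg_homB hg).
- split=> [|x y] /=; first by rewrite (alg_hom1 hf) (alg_hom1 hg).
  by rewrite (alg_homM hf) (alg_homM hg).
- by rewrite (alg_hom_scalar hf) (alg_hom_scalar hg).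
Qed.

Section Scalar.
Variables (K : fieldType) (A : pzAlgType K).

Lemma pzscalar0 : pzscalar (0 : K) = 0 :> A.
Proof. by rewrite -(subrr 0) pzscalar_is_zmod_morphism subrr. Qed.

Lemma pzscalar1 : pzscalar (1 : K) = 1 :> A.
Proof. by have [] := @pzscalar_is_monoid_morphism K A. Qed.

Lemma pzscalarM (k l : K) : pzscalar (k * l) = pzscalar k * pzscalar l :> A.
Proof. by have [_] := @pzscalar_is_monoid_morphism K A. Qed.

Lemma pzscalarCA (k : K) (x y : A) : x * (pzscalar k * y) = pzscalar k * (x * y).
Proof. by rewrite mulrA -pzscalar_comm mulrA. Qed.

End Scalar.

(** * Linear extension from a basis *)

Section LinExt.
Variables (K : fieldType) (M : monoidType) (V : pzAlgType K) (h : M -> V).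

Definition lin_ext (g : monoid_alg K M) : V :=
  \sum_(m <- msupp g) pzscalar g@_m * h m.

(** The support may be replaced by any larger finite set, so that several elements can be summed
    over a common one. *)
Lemma lin_extw (d : {fset M}) (g : monoid_alg K M) : (msupp g `<=` d)%fset ->
  lin_ext g = \sum_(m <- d) pzscalar g@_m * h m.
Proof.
move=> gd; rewrite /lin_ext (big_fset_incl _ gd) //= => m _ /mcoeff_outdom ->.
by rewrite pzscalar0 mul0r.
Qed.

Lemma lin_ext_zmod : zmod_morphism lin_ext.
Proof.
move=> g1 g2; set d := (msupp g1 `|` msupp g2)%fset.
rewrite (@lin_extw d (g1 - g2)) ?msuppB_le // (@lin_extw d g1) ?fsubsetUl //.
rewrite (@lin_extw d g2) ?fsubsetUr // -sumrB; apply: eq_bigr => m _.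
by rewrite mcoeffB pzscalar_is_zmod_morphism mulrBl.
Qed.

Lemma lin_extU (c : K) (m : M) :
  lin_ext (<< c *g m >> : monoid_alg K M) = pzscalar c * h m.
Proof. by rewrite (lin_extw msuppU_le) big_seq_fset1 mcoeffUU. Qed.

Lemma lin_ext_basis m : lin_ext (basis_elt K m) = h m.
Proof. by rewrite lin_extU pzscalar1 mul1r. Qed.

Lemma lin_extZ (k : K) (g : monoid_alg K M) :
  lin_ext (pzscalar k * g) = pzscalar k * lin_ext g.
Proof.
have eD := zmod_morphismD lin_ext_zmod; have e0 := zmod_morphism0 lin_ext_zmod.
elim/monoid_alg_ind: g => [|g1 g2 e1 e2|c m].
- by rewrite mulr0 e0 mulr0.
- by rewrite mulrDr !eD e1 e2 mulrDr.
rewrite -[_ * _]/(monoid_alg_mul _ _) monoid_alg_mulUU mul1g !lin_extU.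
by rewrite pzscalarM mulrA.
Qed.

(** Both sides are bilinear in the two factors, which reduces multiplicativity to basis elements;
    there the coefficients can be collected because they are central. *)
Lemma lin_ext_alg_hom : h 1%g = 1 -> (forall m m', h (m * m')%g = h m * h m') ->
  alg_hom lin_ext.
Proof.
move=> h1 hM; split; first exact: lin_ext_zmod.
  split=> [|g g']; first by rewrite -[RHS]h1 -lin_ext_basis.
  have eD := zmod_morphismD lin_ext_zmod; have e0 := zmod_morphism0 lin_ext_zmod.
  elim/monoid_alg_ind: g => [|g1 g2 e1 e2|c m]; first by rewrite !(mul0r, e0).
    by rewrite mulrDl !eD e1 e2 mulrDl.
  elim/monoid_alg_ind: g' => [|g1 g2 e1 e2|c' m']; first by rewrite !(mulr0, e0).
    by rewrite mulrDr !eD e1 e2 mulrDr.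
  rewrite -[_ * _]/(monoid_alg_mul _ _) monoid_alg_mulUU !lin_extU pzscalarM hM.
  by rewrite -!mulrA [h m * (_ * _)]pzscalarCA.
by move=> k; rewrite lin_extU h1 mulr1.
Qed.

End LinExt.

Section LinExtFun.
Variables (K : fieldType) (M : monoidType) (V : pzAlgType K).
Implicit Types (h : M -> V) (g : monoid_alg K M).

Lemma eq_lin_ext h h' g : h =1 h' -> lin_ext h g = lin_ext h' g.
Proof. by move=> e; apply: eq_bigr => m _; rewrite e. Qed.

Lemma lin_extDf h h' g : lin_ext (fun m => h m + h' m) g = lin_ext h g + lin_ext h' g.
Proof. by rewrite -big_split; apply: eq_bigr => m _; rewrite mulrDr. Qed.

Lemma lin_extZf k h g : lin_ext (fun m => pzscalar k * h m) g = pzscalar k * lin_ext h g.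
Proof. by rewrite mulr_sumr; apply: eq_bigr => m _; rewrite pzscalarCA. Qed.

End LinExtFun.

Lemma monalgU_scalar (K : fieldType) (M : monoidType) (c : K) (m : M) :
  << c *g m >> = pzscalar c * basis_elt K m :> monoid_alg K M.
Proof.
by rewrite -[RHS]/(monoid_alg_mul _ _) monoid_alg_mulUU mulr1 mul1g.
Qed.

(** * Maps out of quotients and tensor products *)

Section QuotLift.
Variables (K : fieldType) (A B : pzAlgType K) (S : A -> Prop) (f : A -> B).

(** Evaluates f on a chosen representative; [quot_liftE] gives independence of the choice. It asks
    only for an additive f, since the maps p_mu on U~' are not multiplicative in general. *)
Definition quot_lift (x : alg_quot S) : B := f (repr x).

Lemma quot_liftE x : zmod_morphism f -> (forall y, gen_ideal S y -> f y = 0) ->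
  quot_lift (to_quot S x) = f x.
Proof. by move=> fB fS; apply/eqP; rewrite -subr_eq0 -fB fS //; apply: to_quot_reprB. Qed.

Lemma quot_lift_zmod : zmod_morphism f -> (forall y, gen_ideal S y -> f y = 0) ->
  zmod_morphism quot_lift.
Proof.
move=> fB fS x y; rewrite -[x]to_quot_repr -[y]to_quot_repr -to_quotB.
by rewrite !quot_liftE.
Qed.

Lemma quot_lift_alg_hom : alg_hom f -> (forall y, S y -> f y = 0) ->
  alg_hom quot_lift /\ forall x, quot_lift (to_quot S x) = f x.
Proof.
move=> hf fS; have fI y : gen_ideal S y -> f y = 0 by apply: alg_hom_ideal fS.
have E x : quot_lift (to_quot S x) = f x by apply: quot_liftE (alg_homB hf) fI.
split=> //; split; first exact: quot_lift_zmod (alg_homB hf) fI.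
  split=> [|x y]; first by rewrite -[RHS](alg_hom1 hf) -E.
  rewrite -[x]to_quot_repr -[y]to_quot_repr -to_quotM.
  by rewrite !E (alg_homM hf).
by move=> k; rewrite -(alg_hom_scalar hf) -E.
Qed.

End QuotLift.

(** For a merely additive f, vanishing on S does not suffice: f has to kill every product a y b with
    y in S. *)
Lemma gen_ideal_zmod (A : pzRingType) (V : zmodType) (S : A -> Prop) (f : A -> V) x :
  zmod_morphism f -> (forall y a b, S y -> f (a * y * b) = 0) ->
  gen_ideal S x -> f x = 0.
Proof.
move=> fB fS Sx; have fD := zmod_morphismD fB; have f0 := zmod_morphism0 fB.
(* With both outer factors quantified, the induction absorbs one-sided multiplications into them. *)
suff H a b : f (a * x * b) = 0 by have := H 1 1; rewrite mul1r mulr1.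
elim: Sx a b => {x} [x Sx a b|a b|x y _ IHx _ IHy a b|c x _ IHx a b|c x _ IHx a b].
- exact: fS.
- by rewrite mulr0 mul0r.
- by rewrite mulrDr mulrDl fD IHx IHy addr0.
- by rewrite mulrA IHx.
- by rewrite mulrA -mulrA IHx.
Qed.

(** By linearity the outer factors need only run over a spanning set B. That B spans is expressed as
    an induction principle. *)
Lemma gen_ideal_spanned (K : fieldType) (P V : pzAlgType K) (S B : P -> Prop)
    (f : P -> V) (x : P) :
  (forall Q : P -> Prop, Q 0 -> (forall u v, Q u -> Q v -> Q (u + v)) ->
     (forall c b, B b -> Q (pzscalar c * b)) -> forall u, Q u) ->
  zmod_morphism f -> (forall k y, f (pzscalar k * y) = pzscalar k * f y) ->
  (forall y u v, S y -> B u -> B v -> f (u * y * v) = 0) ->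
  gen_ideal S x -> f x = 0.
Proof.
move=> span fB fZ fS; apply: gen_ideal_zmod => // {}x u v Sx.
have fD := zmod_morphismD fB; have f0 := zmod_morphism0 fB.
elim/span: u => [|u1 u2 e1 e2|c u Bu]; first by rewrite !mul0r f0.
  by rewrite !mulrDl fD e1 e2 addr0.
elim/span: v => [|v1 v2 e1 e2|d v Bv]; first by rewrite !mulr0 f0.
  by rewrite !mulrDr fD e1 e2 addr0.
by rewrite pzscalarCA -[_ * u * x]mulrA -[_ * (u * x) * v]mulrA !fZ fS // !mulr0.
Qed.

Section PureTensor.
Variables (K : fieldType) (A B : pzAlgType K).
Local Notation pure := (@pure_tensor K A B).

Lemma pure_tensorDl a a' b : pure (a + a') b = pure a b + pure a' b.
Proof.
by rewrite /pure_tensor -to_quotD; apply/to_quot_eq/gen_ideal_gen/TensorDl.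
Qed.

Lemma pure_tensorDr a b b' : pure a (b + b') = pure a b + pure a b'.
Proof.
by rewrite /pure_tensor -to_quotD; apply/to_quot_eq/gen_ideal_gen/TensorDr.
Qed.

Lemma pure_tensorZl k a b : pure (pzscalar k * a) b = pzscalar k * pure a b.
Proof.
rewrite /pure_tensor -(alg_hom_scalar (to_quot_alg_hom (@bilinear_relator K A B))).
rewrite -to_quotM; exact/to_quot_eq/gen_ideal_gen/TensorZl.
Qed.

Lemma pure_tensorZr k a b : pure a (pzscalar k * b) = pzscalar k * pure a b.
Proof.
rewrite /pure_tensor -(alg_hom_scalar (to_quot_alg_hom (@bilinear_relator K A B))).
rewrite -to_quotM; exact/to_quot_eq/gen_ideal_gen/TensorZr.
Qed.

Lemma pure_tensor_zmodr a : zmod_morphism (pure a).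
Proof.
by move=> x y; apply/eqP; rewrite eq_sym subr_eq -pure_tensorDr subrK.
Qed.

Lemma pure_tensor_zmodl b : zmod_morphism (fun a => pure a b).
Proof.
by move=> x y; apply/eqP; rewrite eq_sym subr_eq -pure_tensorDl subrK.
Qed.

Lemma pure_tensor_scalar k : pure (pzscalar k) 1 = pzscalar k.
Proof. by rewrite -[pzscalar k in LHS]mulr1 pure_tensorZl pure_tensor1 mulr1. Qed.

Lemma tensor_ind (P : tensor A B -> Prop) :
  (forall x y, P x -> P y -> P (x + y)) -> (forall a b, P (pure a b)) ->
  forall x, P x.
Proof.
move=> PD Pp x; rewrite -[x]to_quot_repr; elim/monoid_alg_ind: (repr x) => [|g h|c [a b]].
- rewrite (alg_hom0 (to_quot_alg_hom _)); have := Pp 0 0.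
  by rewrite (zmod_morphism0 (pure_tensor_zmodl 0)).
- by rewrite to_quotD; apply: PD.
by rewrite monalgU_scalar to_quotM; have := Pp (pzscalar c * a) b; rewrite pure_tensorZl.
Qed.

Section Lift.
Variables (V : pzAlgType K) (beta : A -> B -> V).
Hypothesis betaDl : forall a a' b, beta (a + a') b = beta a b + beta a' b.
Hypothesis betaDr : forall a b b', beta a (b + b') = beta a b + beta a b'.
Hypothesis betaZl : forall k a b, beta (pzscalar k * a) b = pzscalar k * beta a b.
Hypothesis betaZr : forall k a b, beta a (pzscalar k * b) = pzscalar k * beta a b.

Definition tensor_lift : tensor A B -> V :=
  quot_lift (lin_ext (fun x : tensor_basis A B => beta x.1 x.2)).

Let pre_lift := lin_ext (fun x : tensor_basis A B => beta x.1 x.2).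

(** It suffices to multiply a relator by pure elements on both sides. As a |-> a0 a a1 and b |-> b0
    b b1 are linear, the result vanishes by bilinearity of beta, although f need not be
    multiplicative. *)
Lemma bilinear_ideal (f : pre_tensor A B -> V) x : zmod_morphism f ->
  (forall k g, f (pzscalar k * g) = pzscalar k * f g) ->
  (forall a b, f (pre_pure a b) = beta a b) ->
  gen_ideal (@bilinear_relator K A B) x -> f x = 0.
Proof.
move=> lB lZ lp; have lD := zmod_morphismD lB.
pose pure_elt u := exists a b, u = pre_pure a b :> pre_tensor A B.
apply: (gen_ideal_spanned (B := pure_elt)) => //.
- move=> Q Q0 QD QZ; apply: monoid_alg_ind => // c [a b].
  by rewrite monalgU_scalar; apply: QZ; exists a, b.
move=> {}x u v Sx [a0 [b0 ->]] [a1 [b1 ->]].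
have lM a b : f (pre_pure a0 b0 * pre_pure a b * pre_pure a1 b1)
    = beta (a0 * a * a1) (b0 * b * b1).
  by rewrite -lp; congr (f _); rewrite /pre_pure -!basis_eltM.
have distD (P : pzRingType) (r s y y1 y2 : P) :
    r * (y - (y1 + y2)) * s = r * y * s - (r * y1 * s + r * y2 * s).
  by rewrite mulrBr mulrBl mulrDr mulrDl.
have distZ (P : pzAlgType K) k (r s y y1 : P) :
    r * (y - pzscalar k * y1) * s = r * y * s - pzscalar k * (r * y1 * s).
  by rewrite mulrBr mulrBl pzscalarCA -[_ * (r * y1) * s]mulrA.
case: Sx => [a a' b|a b b'|k a b|k a b].
- rewrite distD lB lD; transitivity (beta (a0 * (a + a') * a1) (b0 * b * b1)
    - (beta (a0 * a * a1) (b0 * b * b1) + beta (a0 * a' * a1) (b0 * b * b1))).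
    by congr (_ - (_ + _)); apply: lM.
  by rewrite mulrDr mulrDl betaDl subrr.
- rewrite distD lB lD; transitivity (beta (a0 * a * a1) (b0 * (b + b') * b1)
    - (beta (a0 * a * a1) (b0 * b * b1) + beta (a0 * a * a1) (b0 * b' * b1))).
    by congr (_ - (_ + _)); apply: lM.
  by rewrite mulrDr mulrDl betaDr subrr.
- rewrite distZ lB lZ; transitivity (beta (a0 * (pzscalar k * a) * a1) (b0 * b * b1)
    - pzscalar k * beta (a0 * a * a1) (b0 * b * b1)).
    by congr (_ - _ * _); apply: lM.
  by rewrite pzscalarCA -[_ * _ * a1]mulrA betaZl subrr.
- rewrite distZ lB lZ; transitivity (beta (a0 * a * a1) (b0 * (pzscalar k * b) * b1)
    - pzscalar k * beta (a0 * a * a1) (b0 * b * b1)).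
    by congr (_ - _ * _); apply: lM.
  by rewrite pzscalarCA -[_ * _ * b1]mulrA betaZr subrr.
Qed.

Let pre_lift_ideal x : gen_ideal (@bilinear_relator K A B) x -> pre_lift x = 0.
Proof.
apply: bilinear_ideal; [exact: lin_ext_zmod | exact: lin_extZ|].
by move=> a b; rewrite /pre_lift lin_ext_basis.
Qed.

Lemma tensor_lift_zmod : zmod_morphism tensor_lift.
Proof. exact: quot_lift_zmod (lin_ext_zmod _) pre_lift_ideal. Qed.

Lemma tensor_lift_pure a b : tensor_lift (pure a b) = beta a b.
Proof.
rewrite /tensor_lift quot_liftE; first exact: lin_ext_basis.
  exact: lin_ext_zmod.
exact: pre_lift_ideal.
Qed.

End Lift.
End PureTensor.

(** * Triangularity of the R-matrix *)

Section Triangular.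
Variables (K : fieldType) (N n : nat) (w : 'I_N -> 'rV[int]_n).
Local Notation E := (@delta_mx K N N).

(** The flip exchanges the two column indices; in particular E_ij (x) E_ji becomes the diagonal unit
    E_ii (x) E_jj. *)
Lemma delta_tens_flip (i j k l : 'I_N) :
  (E i j *t E k l) *m flip_mx K N = E i l *t E k j.
Proof.
rewrite /flip_mx mulmx_sumr (bigD1 j) //= mulmx_sumr (bigD1 l) //=.
rewrite tensmx_mul !mul_delta_mx !big1 ?addr0 // => [a aj|b bl].
  rewrite mulmx_sumr big1 // => b _.
  by rewrite tensmx_mul mul_delta_mx_0 ?tens0mx // eq_sym.
by rewrite tensmx_mul [E k l *m _]mul_delta_mx_0 ?tensmx0 // eq_sym.
Qed.

(** Off the diagonal d, strictly lower triangular in the first tensor factor and strictly upper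
    triangular in the second. The equation for w is weight preservation. *)
Definition triangular (d : 'I_N -> 'I_N -> K) (M : 'M[K]_(N * N)) : Prop :=
  (forall a b, M (mxtens_index (a, b)) (mxtens_index (a, b)) = d a b) /\
  (forall a b x y, M (mxtens_index (a, b)) (mxtens_index (x, y)) != 0 ->
     (a = x /\ b = y) \/ [/\ (x < a)%N, (b < y)%N & w a + w b = w x + w y]).

(** Triangularity after the flip, in a form that can be checked on the separate sums defining hat
    R_q. *)
Definition hat_triangular d M := triangular d (M *m flip_mx K N).

Lemma hat_triangular_ext d1 d2 M : (forall a b, d1 a b = d2 a b) ->
  hat_triangular d1 M -> hat_triangular d2 M.
Proof. by move=> e [h1 h2]; split=> // a b; rewrite h1. Qed.

Lemma hat_triangular0 : hat_triangular (fun _ _ => 0) 0.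
Proof.
by rewrite /hat_triangular mul0mx; split=> [a b|a b x y]; rewrite mxE ?eqxx.
Qed.

Lemma hat_triangularD d1 d2 M1 M2 : hat_triangular d1 M1 -> hat_triangular d2 M2 ->
  hat_triangular (fun a b => d1 a b + d2 a b) (M1 + M2).
Proof.
move=> [e1 h1] [e2 h2]; rewrite /hat_triangular mulmxDl.
split=> [a b|a b x y]; first by rewrite mxE e1 e2.
rewrite mxE; set m1 := (M1 *m _) _ _.
have [z1|/h1 //] := eqVneq m1 0.
by rewrite z1 add0r => /h2.
Qed.

Lemma hat_triangularZ c d M : hat_triangular d M ->
  hat_triangular (fun a b => c * d a b) (c *: M).
Proof.
move=> [e h]; rewrite /hat_triangular -scalemxAl; split=> [a b|a b x y].
  by rewrite mxE e.
by rewrite mxE mulf_eq0 negb_or => /andP[_ /h].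
Qed.

Lemma hat_triangular_sum (I : Type) (r : seq I) (P : pred I) d (M : I -> 'M[K]_(N * N)) :
  (forall i, P i -> hat_triangular (d i) (M i)) ->
  hat_triangular (fun a b => \sum_(i <- r | P i) d i a b) (\sum_(i <- r | P i) M i).
Proof.
move=> h; elim: r => [|i r IH].
  rewrite big_nil; apply: hat_triangular_ext hat_triangular0 => a b.
  by rewrite big_nil.
rewrite big_cons; case: ifP => Pi.
  apply: hat_triangular_ext (hat_triangularD (h i Pi) IH) => a b.
  by rewrite big_cons Pi.
by apply: hat_triangular_ext IH => a b; rewrite big_cons Pi.
Qed.

Lemma hat_triangular_sum0 (I : Type) (r : seq I) (P : pred I) (M : I -> 'M[K]_(N * N)) :
  (forall i, P i -> hat_triangular (fun _ _ => 0) (M i)) ->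
  hat_triangular (fun _ _ => 0) (\sum_(i <- r | P i) M i).
Proof.
move=> /(@hat_triangular_sum _ r P (fun _ _ _ => 0)).
by apply: hat_triangular_ext => a b; rewrite big1.
Qed.

Lemma hat_triangularZ0 c M : hat_triangular (fun _ _ => 0) M ->
  hat_triangular (fun _ _ => 0) (c *: M).
Proof. by move=> /(hat_triangularZ c); apply: hat_triangular_ext => a b; rewrite mulr0. Qed.

Lemma hat_triangular_diag (i j : 'I_N) :
  hat_triangular (fun a b => ((a == i) && (b == j))%:R) (E i j *t E j i).
Proof.
rewrite /hat_triangular delta_tens_flip; split=> [a b|a b x y].
  by rewrite tensmxE !mxE -natrM mulnb !andbb.
rewrite tensmxE !mxE; case: (a =P i) => [->|_]; last by rewrite mul0r eqxx.
case: (x =P i) => [->|_]; last by rewrite mul0r eqxx.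
case: (b =P j) => [->|_]; last by rewrite mulr0 eqxx.
by case: (y =P j) => [->|_]; [left | rewrite mulr0 eqxx].
Qed.

(** After the flip the matrix is E_il (x) E_kj, so the two inequalities place its only nonzero entry
    strictly off the diagonal. *)
Lemma hat_triangular_strict (i j k l : 'I_N) :
  (l < i)%N -> (k < j)%N -> w i + w k = w l + w j ->
  hat_triangular (fun _ _ => 0) (E i j *t E k l).
Proof.
move=> li kj hw; rewrite /hat_triangular delta_tens_flip; split=> [a b|a b x y].
  rewrite tensmxE !mxE; case: (a =P i) => [->|]; last by rewrite mul0r.
  have /negPf-> : i != l by apply: contraL li => /eqP->; rewrite ltnn.
  by rewrite andbF mul0r.
rewrite tensmxE !mxE; case: (a =P i) => [->|_]; last by rewrite mul0r eqxx.
case: (x =P l) => [->|_]; last by rewrite mul0r eqxx.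
case: (b =P k) => [->|_]; last by rewrite mulr0 eqxx.
by case: (y =P j) => [->|_]; [right | rewrite mulr0 eqxx].
Qed.

Lemma hat_triangular_sum_diag (P : 'I_N -> pred 'I_N) :
  hat_triangular (fun a b => (P a b)%:R)
    (\sum_(i : 'I_N) \sum_(j | P i j) E i j *t E j i).
Proof.
apply: (@hat_triangular_ext
  (fun a b => \sum_(i : 'I_N) \sum_(j | P i j) ((a == i) && (b == j))%:R)); last first.
  apply: hat_triangular_sum => i _; apply: hat_triangular_sum => j _.
  exact: hat_triangular_diag.
move=> a b.
rewrite (bigD1 a) //= [X in _ + X]big1 ?addr0; last first.
  by move=> i /negPf ia; rewrite big1 // => j _; rewrite eq_sym ia.
case: (boolP (P a b)) => Pab.
  rewrite (bigD1 b) //= !eqxx big1 ?addr0 // => j /andP[_ /negPf jb].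
  by rewrite eq_sym jb andbF.
by rewrite big1 // => j Pj; case: (b =P j) => [bj|]; rewrite ?andbF // bj Pj in Pab *.
Qed.

Lemma hat_triangular_sum_diag1 (P : pred 'I_N) (f : 'I_N -> 'I_N) :
  hat_triangular (fun a b => (P a && (b == f a))%:R)
    (\sum_(i : 'I_N | P i) E i (f i) *t E (f i) i).
Proof.
rewrite (_ : \sum_(i | _) _ = \sum_(i : 'I_N) \sum_(j | P i && (j == f i)) E i j *t E j i).
  exact: (hat_triangular_sum_diag (fun i j => P i && (j == f i))).
rewrite [LHS]big_mkcond; apply: eq_bigr => i _; case: (P i) => /=.
  by rewrite big_pred1_eq.
by rewrite big_pred0.
Qed.

Hypothesis w_rev : forall i, w (rev_ord i) = - w i.

(** The bound on m gives i < i' for i < m; row and column both carry the weight w i + w i'. *)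
Lemma hat_triangular_off (c : 'I_N -> K) m : (m.*2 <= N)%N ->
  hat_triangular (fun _ _ => 0)
    (\sum_(i : 'I_N | (i < m)%N) c i *: (E (rev_ord i) (rev_ord i) *t E i i)).
Proof.
move=> mN; apply: hat_triangular_sum0 => i im.
have ii : (i < rev_ord i)%N by rewrite /=; lia.
by apply/hat_triangularZ0/hat_triangular_strict => //; rewrite addrC.
Qed.

Lemma hat_triangular_flip (P : 'I_N -> pred 'I_N) :
  hat_triangular (fun _ _ => 0)
    (\sum_(i : 'I_N) \sum_(j : 'I_N | (j < i)%N && P i j) E i i *t E j j).
Proof.
apply: hat_triangular_sum0 => i _; apply: hat_triangular_sum0 => j /andP[ji _].
by apply: hat_triangular_strict => //; rewrite addrC.
Qed.

(** The flip gives E_i'j' (x) E_ij, where j' < i' because i < j, and both pairs of indices have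
    weight 0. *)
Lemma hat_triangular_contract (P : 'I_N -> pred 'I_N) (c : 'I_N -> 'I_N -> K) :
  hat_triangular (fun _ _ => 0)
    (\sum_(i : 'I_N) \sum_(j : 'I_N | (i < j)%N && P i j)
      c i j *: (E (rev_ord i) j *t E i (rev_ord j))).
Proof.
apply: hat_triangular_sum0 => i _; apply: hat_triangular_sum0 => j /andP[ij _].
apply/hat_triangularZ0/hat_triangular_strict => //=; first by have := ltn_ord j; lia.
by rewrite !w_rev !addNr.
Qed.

End Triangular.

Lemma eps_rev X n (i : 'I_(rdim X n)) : eps (rev_ord i) = - eps i.
Proof. by apply/rowP=> k; rewrite !mxE rev_ordK opprB. Qed.

Lemma rev_ord_fixed X n (i : 'I_(rdim X n)) :
  (rev_ord i == i) = if X is TypeB then i == n :> nat else false.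
Proof.
rewrite -val_eqE; case: X i => i; have := ltn_ord i; rewrite /= => hi;
  by [apply/eqP/eqP; lia | apply/eqP; lia].
Qed.

(** * The R-matrices of types B, C and D *)

Section RqTriangular.
Variables (K : fieldType) (n : nat) (q : K).

(** One summand for each sum in [hatRB], in the same order; the zeros belong to the three strictly
    triangular sums. Off the middle index, the value is q^-2 at b = a and q^2 at b = a'; it is 1 in
    all other cases. *)
Definition diagB (a b : 'I_(rdim TypeB n)) : K :=
  q ^- 2 * ((a != n :> nat) && (b == a))%:R
    + ((a == n :> nat) && (b == a))%:R
    + q ^+ 2 * ((a != n :> nat) && (b == rev_ord a))%:R
    + ((b != a) && (b != rev_ord a))%:R + 0 + 0 + 0.

Lemma hatRB_triangular : hat_triangular (@eps TypeB n) diagB (@hatRB K _ n q).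
Proof.
have wr := @eps_rev TypeB n; pose notmid (i : 'I_(rdim TypeB n)) := i != n :> nat.
rewrite /hatRB; apply: hat_triangularD; last exact/hat_triangularZ0/hat_triangular_contract.
apply: hat_triangularD; last exact/hat_triangularZ0/hat_triangular_flip.
apply: hat_triangularD; last by apply/hat_triangularZ0/hat_triangular_off => //=; lia.
apply: hat_triangularD; last first.
  exact: (hat_triangular_sum_diag _ _ (fun i j => (j != i) && (j != rev_ord i))).
apply: hat_triangularD; last first.
  exact/hat_triangularZ/(hat_triangular_sum_diag1 _ _ notmid (@rev_ord _)).
apply: hat_triangularD; last first.
  exact: (hat_triangular_sum_diag1 _ _ (fun i : 'I_(rdim TypeB n) => i == n :> nat) id).
exact/hat_triangularZ/(hat_triangular_sum_diag1 _ _ notmid id).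
Qed.

Definition diagCD (N : nat) (a b : 'I_N) : K :=
  q^-1 * (b == a)%:R + q * (b == rev_ord a)%:R
    + ((b != a) && (b != rev_ord a))%:R + 0 + 0 + 0.

Lemma hatRC_triangular : hat_triangular (@eps TypeC n) (@diagCD _) (@hatRC K _ n q).
Proof.
have wr := @eps_rev TypeC n.
rewrite /hatRC; apply: hat_triangularD; last exact/hat_triangularZ0/hat_triangular_contract.
apply: hat_triangularD; last exact/hat_triangularZ0/hat_triangular_flip.
apply: hat_triangularD; last by apply/hat_triangularZ0/hat_triangular_off => //=; lia.
apply: hat_triangularD; last first.
  exact: (hat_triangular_sum_diag _ _ (fun i j => (j != i) && (j != rev_ord i))).
apply: hat_triangularD; apply/hat_triangularZ.
  exact: (hat_triangular_sum_diag1 _ _ xpredT id).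
exact: (hat_triangular_sum_diag1 _ _ xpredT (@rev_ord _)).
Qed.

Lemma hatRD_triangular : hat_triangular (@eps TypeD n) (@diagCD _) (@hatRD K _ n q).
Proof.
have wr := @eps_rev TypeD n.
rewrite /hatRD; apply: hat_triangularD; last exact/hat_triangularZ0/hat_triangular_contract.
apply: hat_triangularD; last exact/hat_triangularZ0/hat_triangular_flip.
apply: hat_triangularD; last by apply/hat_triangularZ0/hat_triangular_off => //=; lia.
apply: hat_triangularD; last first.
  exact: (hat_triangular_sum_diag _ _ (fun i j => (j != i) && (j != rev_ord i))).
apply: hat_triangularD; apply/hat_triangularZ.
  exact: (hat_triangular_sum_diag1 _ _ xpredT id).
exact: (hat_triangular_sum_diag1 _ _ xpredT (@rev_ord _)).
Qed.

(** Symmetry of d will make the factors from l_ii^+ and l_ii^- cancel in z_i, and nonvanishing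
    allows dividing by them. *)
Lemma Rq_triangular X : q != 0 -> exists d : 'I_(rdim X n) -> 'I_(rdim X n) -> K,
  [/\ forall a b, d a b = d b a, forall a b, d a b != 0
    & triangular (@eps X n) d (Rq X n q)].
Proof.
move=> q0; have revC (a b : 'I_(rdim X n)) : (a == rev_ord b) = (b == rev_ord a).
  by rewrite -(inj_eq rev_ord_inj) rev_ordK eq_sym.
case: X revC => revC; [exists diagB | exists (@diagCD _) | exists (@diagCD _)]; split;
  rewrite /diagB /diagCD.
(* The middle index is rewritten as the fixed point of i |-> i', which turns the conditions into
   ones on a and b that can be compared after exchange. *)
- move=> a b; rewrite !addr0 -!(@rev_ord_fixed TypeB) (revC a) (eq_sym a b).
  case: (b =P a) => [->//|/eqP ba]; case: (b =P rev_ord a) => [->|_].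
    by rewrite rev_ordK [a == _]eq_sym.
  by rewrite !andbF.
- move=> a b; rewrite !addr0 -(@rev_ord_fixed TypeB); case: (b =P a) => [->|/eqP ba].
    rewrite [a == rev_ord a]eq_sym /=; case: (rev_ord a == a).
      by rewrite !mulr0 addr0 add0r addr0 oner_neq0.
    by rewrite mulr1 mulr0 !addr0 invr_neq0 ?expf_neq0.
  rewrite !andbF mulr0 !add0r /=; case: (b =P rev_ord a) => [eb|_].
    by rewrite -eb ba mulr1 addr0 expf_neq0.
  by rewrite andbF mulr0 add0r oner_neq0.
- exact: hatRB_triangular.
- by move=> a b; rewrite (revC a) (eq_sym a b).
- move=> a b; rewrite !addr0; case: (b =P a) => [->|_].
    by rewrite [a == _]eq_sym (@rev_ord_fixed TypeC) mulr0 mulr1 !addr0 invr_neq0.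
  rewrite mulr0 add0r; case: (b == rev_ord a); first by rewrite mulr1 addr0.
  by rewrite mulr0 add0r oner_neq0.
- exact: hatRC_triangular.
- by move=> a b; rewrite (revC a) (eq_sym a b).
- move=> a b; rewrite !addr0; case: (b =P a) => [->|_].
    by rewrite [a == _]eq_sym (@rev_ord_fixed TypeD) mulr0 mulr1 !addr0 invr_neq0.
  rewrite mulr0 add0r; case: (b == rev_ord a); first by rewrite mulr1 addr0.
  by rewrite mulr0 add0r oner_neq0.
- exact: hatRD_triangular.
Qed.

End RqTriangular.

(** * The universal property of the algebra *)

Section MapMx.
Variables (K : fieldType) (A B : pzAlgType K) (f : A -> B).
Hypothesis hf : alg_hom f.

Lemma map_mx_alg_homM m n p (M : 'M[A]_(m, n)) (M' : 'M[A]_(n, p)) :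
  map_mx f (M *m M') = map_mx f M *m map_mx f M'.
Proof.
apply/matrixP=> i j; rewrite !mxE (zmod_morphism_sum (alg_homB hf)).
by apply: eq_bigr => k _; rewrite (alg_homM hf) !mxE.
Qed.

Lemma map_mx_alg_homB m n (M M' : 'M[A]_(m, n)) :
  map_mx f (M - M') = map_mx f M - map_mx f M'.
Proof. by apply/matrixP=> i j; rewrite !mxE (alg_homB hf). Qed.

Lemma map_mx_alg_hom1 n : map_mx f (1%:M : 'M[A]_n) = 1%:M.
Proof.
apply/matrixP=> i j; rewrite !mxE.
by case: (i == j); rewrite ?(alg_hom1 hf) ?(alg_hom0 hf).
Qed.

Lemma map_mx_alg_hom_scal m n (M : 'M[K]_(m, n)) :
  map_mx f (scal_mx A M) = scal_mx B M.
Proof. by apply/matrixP=> i j; rewrite !mxE (alg_hom_scalar hf). Qed.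

Lemma map_mx_anti_tr n (M : 'M[A]_n) : map_mx f (anti_tr M) = anti_tr (map_mx f M).
Proof. by apply/matrixP=> i j; rewrite !mxE. Qed.

End MapMx.

Section ScalMx.
Variables (K : fieldType) (A : pzAlgType K).

Lemma scal_mxM m n p (M : 'M[K]_(m, n)) (M' : 'M[K]_(n, p)) :
  scal_mx A (M *m M') = scal_mx A M *m scal_mx A M'.
Proof.
apply/matrixP=> i j; rewrite !mxE (zmod_morphism_sum (@pzscalar_is_zmod_morphism K A)).
by apply: eq_bigr => k _; rewrite pzscalarM !mxE.
Qed.

Lemma scal_mx1 n : scal_mx A (1%:M : 'M[K]_n) = 1%:M.
Proof.
apply/matrixP=> i j; rewrite !mxE.
by case: (i == j); rewrite ?pzscalar1 ?pzscalar0.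
Qed.

Lemma scal_mxVK n p (C : 'M[K]_n) (M M' : 'M[A]_(p, n)) : C \in unitmx ->
  M *m scal_mx A (invmx C) = M' <-> M = M' *m scal_mx A C.
Proof.
move=> Cu; split=> [<-|->]; rewrite -mulmxA -scal_mxM.
  by rewrite mulVmx // scal_mx1 mulmx1.
by rewrite mulmxV // scal_mx1 mulmx1.
Qed.

End ScalMx.

Lemma sum_mxtens (V : nmodType) m n (F : 'I_(m * n) -> V) :
  \sum_p F p = \sum_(a < m) \sum_(b < n) F (mxtens_index (a, b)).
Proof.
rewrite pair_bigA /= (reindex (@mxtens_index m n)) /=.
  by apply: eq_bigr => -[a b].
by exists (@mxtens_unindex m n) => p _; rewrite ?mxtens_indexK ?mxtens_unindexK.
Qed.

Section TensEntries.
Variables (A : pzRingType) (N : nat) (M M' : 'M[A]_N).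

(** The entries need not commute, so the order of the factors is what distinguishes L_1 L_2 here
    from L_2 L_1 in [tensmx1M2E]. *)
Lemma tensmx1M1E (a b j l : 'I_N) :
  ((M *t 1%:M) *m (1%:M *t M')) (mxtens_index (a, b)) (mxtens_index (j, l)) =
  M a j * M' b l.
Proof.
rewrite mxE sum_mxtens (bigD1 j) //= [X in _ + X]big1 ?addr0; last first.
  move=> c cj; rewrite big1 // => d _.
  by rewrite !tensmxE !mxE (negPf cj) mul0r mulr0.
rewrite (bigD1 b) //= [X in _ + X]big1 ?addr0; last first.
  by move=> d db; rewrite !tensmxE !mxE eq_sym (negPf db) mulr0 mul0r.
by rewrite !tensmxE !mxE !eqxx mulr1 mul1r.
Qed.

Lemma tensmx1M2E (i k a b : 'I_N) :
  ((1%:M *t M') *m (M *t 1%:M)) (mxtens_index (i, k)) (mxtens_index (a, b)) =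
  M' k b * M i a.
Proof.
rewrite mxE sum_mxtens (bigD1 i) //= [X in _ + X]big1 ?addr0; last first.
  move=> c ci; rewrite big1 // => d _.
  by rewrite !tensmxE !mxE eq_sym (negPf ci) !mul0r.
rewrite (bigD1 b) //= [X in _ + X]big1 ?addr0; last first.
  by move=> d db; rewrite !tensmxE !mxE (negPf db) !mulr0.
by rewrite !tensmxE !mxE !eqxx mulr1 mul1r.
Qed.

End TensEntries.

Section Relations.
Variables (K : fieldType) (X : cartan_type) (n : nat) (q : K).
Hypothesis q0 : q != 0.
Local Notation N := (rdim X n).
Local Notation R := (Rq X n q).
Local Notation C := (Cq X n q).
Local Notation F := (free_alg K (ell_gen N)).
Local Notation r i k j l := (R (mxtens_index (i, k)) (mxtens_index (j, l))).

Definition RLL_eqs (B : pzAlgType K) (y y' : 'I_N -> 'I_N -> B) : Prop :=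
  forall i k j l,
    \sum_a \sum_b pzscalar (r i k a b) * (y a j * y' b l) =
    \sum_a \sum_b y' k b * y i a * pzscalar (r a b j l).

(** The defining relations of U~ for families in an arbitrary algebra. Orthogonality takes the form
    L C L^t' = C, free of the inverse of C. *)
Definition tU_eqs (B : pzAlgType K) (y : bool -> 'I_N -> 'I_N -> B)
    (v : bool -> 'I_N -> B) : Prop :=
  [/\ forall s i j, ~~ ell_support (s, i, j) -> y s i j = 0,
      [/\ RLL_eqs (y true) (y true), RLL_eqs (y false) (y false)
        & RLL_eqs (y true) (y false)],
      forall s i, y s i i * v s i = 1 /\ v s i * y s i i = 1,
      forall s i k, \sum_j y s i j * pzscalar (C j j) * y s (rev_ord k) (rev_ord j)
        = pzscalar (C i k)
    & forall s (i : 'I_N), X = TypeB -> i = n :> nat -> y s i i = 1].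

Lemma Cq_offdiag i k : i != k -> C i k = 0.
Proof. by move=> /negPf ik; rewrite !mxE ik mulr0n. Qed.

Lemma Cq_unit : C \in unitmx.
Proof.
rewrite unitmxE det_diag unitfE; apply/prodf_neq0 => i _; rewrite mxE.
case: (X) i => i; first exact: expfz_neq0.
  by rewrite mulf_neq0 ?expfz_neq0 //; case: ifP; rewrite ?oppr_eq0 oner_neq0.
exact: expfz_neq0.
Qed.

Lemma tU_eqs_alg_hom (B B' : pzAlgType K) (f : B -> B') y v : alg_hom f ->
  tU_eqs y v -> tU_eqs (fun s i j => f (y s i j)) (fun s i => f (v s i)).
Proof.
move=> hf [y0 [r1 r2 r3] yv yo ym].
have rll z z' : RLL_eqs z z' -> RLL_eqs (fun i j => f (z i j)) (fun i j => f (z' i j)).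
  move=> e i k j l; have := congr1 f (e i k j l).
  rewrite !(zmod_morphism_sum (alg_homB hf)) => e'; apply: etrans (etrans _ e') _.
    apply: eq_bigr => a _; rewrite (zmod_morphism_sum (alg_homB hf)).
    by apply: eq_bigr => b _; rewrite !(alg_homM hf) (alg_hom_scalar hf).
  apply: eq_bigr => a _; rewrite (zmod_morphism_sum (alg_homB hf)).
  by apply: eq_bigr => b _; rewrite !(alg_homM hf) (alg_hom_scalar hf).
split.
- by move=> s i j /y0->; apply: alg_hom0.
- by split; apply: rll.
- by move=> s i; rewrite -!(alg_homM hf) !(yv s i).1 (yv s i).2 (alg_hom1 hf).
- move=> s i k; rewrite -(alg_hom_scalar hf) -(yo s i k).
  rewrite (zmod_morphism_sum (alg_homB hf)); apply: eq_bigr => j _.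
  by rewrite !(alg_homM hf) (alg_hom_scalar hf).
- by move=> s i XB i_n; rewrite ym // (alg_hom1 hf).
Qed.

Lemma RLL_entry (B : pzAlgType K) (f : F -> B) s s' i k j l : alg_hom f ->
  f (RLL R s s' (mxtens_index (i, k)) (mxtens_index (j, l))) =
  (\sum_a \sum_b pzscalar (r i k a b) * (f (free_L K N s a j) * f (free_L K N s' b l)))
  - \sum_a \sum_b f (free_L K N s' k b) * f (free_L K N s i a) * pzscalar (r a b j l).
Proof.
move=> hf; rewrite /RLL -mulmxA; set L12 := (_ *m _); set L21 := (_ *m _).
rewrite mxE [X in f (X + _)]mxE [X in f (_ + X)]mxE (alg_homB hf).
rewrite ![(_ *m _) _ _]mxE !sum_mxtens !(zmod_morphism_sum (alg_homB hf)).
congr (_ - _); apply: eq_bigr => a _; rewrite (zmod_morphism_sum (alg_homB hf)).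
  by apply: eq_bigr => b _;
    rewrite tensmx1M1E !(alg_homM hf) [scal_mx _ _ _ _]mxE (alg_hom_scalar hf).
by apply: eq_bigr => b _;
    rewrite tensmx1M2E !(alg_homM hf) [scal_mx _ _ _ _]mxE (alg_hom_scalar hf).
Qed.

Lemma RLL_eqsP (B : pzAlgType K) (f : F -> B) s s' : alg_hom f ->
  (RLL_eqs (fun i j => f (free_L K N s i j)) (fun i j => f (free_L K N s' i j)) <->
   forall x, is_entry (RLL R s s') x -> f x = 0).
Proof.
move=> hf; split=> [e x [ik [jl ->]]|e i k j l].
  rewrite -[ik]mxtens_unindexK -[jl]mxtens_unindexK.
  case: (mxtens_unindex ik) (mxtens_unindex jl) => i k [j l].
  by rewrite RLL_entry // e subrr.
apply/eqP; rewrite -subr_eq0 -RLL_entry //; apply/eqP/e; by do 2 eexists.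
Qed.

Lemma orth_eqsP (B : pzAlgType K) (f : UR R -> B) s : alg_hom f ->
  ((forall i k, \sum_j f (UR_L R s i j) * pzscalar (C j j)
       * f (UR_L R s (rev_ord k) (rev_ord j)) = pzscalar (C i k)) <->
   forall x, is_entry (orth_mx X n q s) x -> f x = 0).
Proof.
move=> hf; pose L := map_mx f (UR_L R s).
have fo : map_mx f (orth_mx X n q s) =
    L *m scal_mx B C *m anti_tr L *m scal_mx B (invmx C) - 1%:M.
  rewrite /orth_mx map_mx_alg_homB // !map_mx_alg_homM // !map_mx_alg_hom_scal //.
  by rewrite map_mx_alg_hom1 // map_mx_anti_tr.
have LE i k : (L *m scal_mx B C *m anti_tr L) i k =
    \sum_j f (UR_L R s i j) * pzscalar (C j j) * f (UR_L R s (rev_ord k) (rev_ord j)).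
  rewrite mxE; apply: eq_bigr => j _; rewrite mxE (bigD1 j) //= big1 ?addr0.
    by rewrite !mxE.
  by move=> a aj; rewrite [scal_mx _ _ _ _]mxE Cq_offdiag // pzscalar0 mulr0.
have H : (forall i k, \sum_j f (UR_L R s i j) * pzscalar (C j j)
       * f (UR_L R s (rev_ord k) (rev_ord j)) = pzscalar (C i k)) <->
    L *m scal_mx B C *m anti_tr L *m scal_mx B (invmx C) = 1%:M.
  rewrite scal_mxVK ?Cq_unit // mul1mx; split=> [e|e i k].
    by apply/matrixP=> i k; rewrite LE e [RHS]mxE.
  by rewrite -LE e mxE.
rewrite H; split=> [e x [i [j ->]]|e].
  have := congr1 (fun M : 'M_N => M i j) fo; rewrite e subrr mxE => ->.
  by rewrite mxE.
apply/eqP; rewrite -subr_eq0 -fo; apply/eqP/matrixP=> i j; rewrite [RHS]mxE [LHS]mxE.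
by apply: e; exists i, j.
Qed.

End Relations.

Section UniversalProperty.
Variables (K : fieldType) (X : cartan_type) (n : nat) (q : K).
Hypothesis q0 : q != 0.
Local Notation N := (rdim X n).
Local Notation R := (Rq X n q).
Local Notation F := (free_alg K (ell_gen N)).
Local Notation U := (tU X n q).

Let piU : F -> UR R := to_quot (U_relator R).
Let piT : UR R -> U := to_quot (@tU_relator K X n q).
Let piU_hom : alg_hom piU := to_quot_alg_hom _.
Let piT_hom : alg_hom piT := to_quot_alg_hom _.
Let pi_hom : alg_hom (piT \o piU) := alg_hom_comp piT_hom piU_hom.

Lemma to_quot_gen (A : pzAlgType K) (S : A -> Prop) x : S x -> to_quot S x = 0.
Proof.
move=> Sx; rewrite -(alg_hom0 (to_quot_alg_hom S)); apply/to_quot_eq.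
by rewrite subr0; apply: gen_ideal_gen.
Qed.

Lemma tU_LE s i j : @tU_L K X n q s i j = piT (piU (free_L K N s i j)).
Proof. by rewrite mxE [UR_L _ _ _ _]mxE. Qed.

Lemma tU_eqs_tU : tU_eqs q (fun s i j => @tU_L K X n q s i j) (@tU_inv K X n q).
Proof.
have rll s s' : (forall x, is_entry (RLL R s s') x -> U_relator R x) ->
    RLL_eqs q (fun i j => @tU_L K X n q s i j) (fun i j => @tU_L K X n q s' i j).
  move=> H; have := (RLL_eqsP q s s' pi_hom).2.
  move=> /(_ _) e i k j l; have {}e := e _ i k j l.
  under eq_bigr do under eq_bigr do rewrite !tU_LE.
  under [RHS]eq_bigr do under eq_bigr do rewrite !tU_LE.
  apply: e => x /H Ux; rewrite /= -[RHS](alg_hom0 piT_hom); congr (piT _).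
  exact: to_quot_gen.
split.
- move=> s i j sij; rewrite tU_LE mxE insubN // (alg_hom0 piU_hom); exact: alg_hom0.
- by split; apply: rll => x xE; [apply: U_RLL_same xE|apply: U_RLL_same xE|apply: U_RLL_mixed].
- move=> s i; rewrite tU_LE -[tU_inv _ _ _]/(piT (piU (free_inv K s i))).
  rewrite -!(alg_homM piT_hom) -!(alg_homM piU_hom) -(alg_hom1 piT_hom) -(alg_hom1 piU_hom).
  split; congr (piT _); apply/to_quot_eq/gen_ideal_gen; [exact: U_mulV|exact: U_mulVl].
- move=> s i k; have := (orth_eqsP q0 s piT_hom).2 => e.
  rewrite -[RHS]e; last by move=> x xE; apply/to_quot_gen/tU_orth/xE.
  by apply: eq_bigr => j _; rewrite !tU_LE ![UR_L _ _ _ _]mxE.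
- move=> s i XB i_n; rewrite mxE -(alg_hom1 piT_hom).
  by apply/to_quot_eq/gen_ideal_gen/tU_mid.
Qed.

Lemma free_genE s i j (h : ell_support (s, i, j)) :
  free_gen K (inl (exist _ (s, i, j) h) : ell_gen N) = free_L K N s i j.
Proof. by rewrite mxE insubT. Qed.

(** Words in the generators span, and they grow by one letter on the left; the scalars account for
    the empty word and for 0. *)
Lemma tU_ind (P : U -> Prop) :
  (forall x y, P x -> P y -> P (x + y)) -> (forall k, P (pzscalar k)) ->
  (forall s i j x, P x -> P (@tU_L K X n q s i j * x)) ->
  (forall s i x, P x -> P (@tU_inv K X n q s i * x)) -> forall x, P x.
Proof.
move=> PD Pk PL Pv x; rewrite -[x]to_quot_repr -[repr x]to_quot_repr.
move: (repr (repr x)) => {x} g; rewrite -/(piU g) -/(piT (piU g)).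
elim/monoid_alg_ind: g => [|g g' Pg Pg'|c w].
- by rewrite (alg_hom0 piU_hom) (alg_hom0 piT_hom) -(pzscalar0 U).
- by rewrite (alg_homD piU_hom) (alg_homD piT_hom); apply: PD.
elim: w => [|a w IH].
  by have := Pk c; rewrite -(alg_hom_scalar piT_hom) -(alg_hom_scalar piU_hom).
have -> : << c *g (a :: w) >> = free_gen K a * << c *g (w : word (ell_gen N)) >> :> F.
  by rewrite -[RHS]/(monoid_alg_mul _ _) monoid_alg_mulUU mul1r.
rewrite (alg_homM piU_hom) (alg_homM piT_hom).
case: a => [[[[s i] j] h]|[s i]]; last exact: Pv.
by rewrite free_genE -tU_LE; apply: PL.
Qed.

(** Two-sided inverses are unique, so agreement on the l_ii forces agreement on their inverses. *)
Lemma alg_hom_tU_inv (B : pzAlgType K) (f g : U -> B) : alg_hom f -> alg_hom g ->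
  (forall s i j, f (@tU_L K X n q s i j) = g (@tU_L K X n q s i j)) ->
  forall s i, f (@tU_inv K X n q s i) = g (@tU_inv K X n q s i).
Proof.
move=> hf hg fg s i; have [_ _ /(_ s i)[Lv vL] _ _] := tU_eqs_tU.
rewrite -[RHS]mul1r -(alg_hom1 hf) -vL (alg_homM hf) fg -mulrA -(alg_homM hg) Lv.
by rewrite (alg_hom1 hg) mulr1.
Qed.

Lemma tU_hom_ext (B : pzAlgType K) (f g : U -> B) : alg_hom f -> alg_hom g ->
  (forall s i j, f (@tU_L K X n q s i j) = g (@tU_L K X n q s i j)) -> f = g.
Proof.
move=> hf hg fg; apply/funext; apply: tU_ind => [x y ex ey|k|s i j x e|s i x e].
- by rewrite (alg_homD hf) ex ey (alg_homD hg).
- by rewrite (alg_hom_scalar hf) (alg_hom_scalar hg).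
- by rewrite (alg_homM hf) e fg (alg_homM hg).
- by rewrite (alg_homM hf) e (alg_hom_tU_inv hf hg fg) (alg_homM hg).
Qed.

(** The map is built on the free algebra and then descends twice, first to U(R) and then to U~. *)
Lemma tU_universal (B : pzAlgType K) (y : bool -> 'I_N -> 'I_N -> B) v :
  tU_eqs q y v -> exists f : U -> B, [/\ alg_hom f,
    forall s i j, f (@tU_L K X n q s i j) = y s i j
    & forall s i, f (@tU_inv K X n q s i) = v s i].
Proof.
move=> [y0 [r1 r2 r3] yv yo ym].
pose h (a : ell_gen N) : B := match a with
  | inl u => let: (s, i, j) := val u in y s i j
  | inr (s, i) => v s i end.
pose f0 : F -> B := lin_ext (fun w : word (ell_gen N) => \prod_(a <- (w : seq _)) h a).
have f0_hom : alg_hom f0.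
  by apply: lin_ext_alg_hom => [|w w']; [exact: big_nil | exact: big_cat].
have f0_gen a : f0 (free_gen K a) = h a by rewrite /f0 lin_ext_basis big_seq1.
have f0L s i j : f0 (free_L K N s i j) = y s i j.
  rewrite mxE; case: insubP => [u _ uE|/y0->]; last exact: alg_hom0.
  by rewrite f0_gen /= uE.
have f0U x : U_relator R x -> f0 x = 0.
  have rll s s' : RLL_eqs q (y s) (y s') ->
      forall x, is_entry (RLL R s s') x -> f0 x = 0.
    move=> e; apply/(RLL_eqsP q s s' f0_hom) => i k j l.
    under eq_bigr do under eq_bigr do rewrite !f0L.
    by under [RHS]eq_bigr do under eq_bigr do rewrite !f0L.
  case=> {x} [s x|x|s i|s i]; first by apply: rll; case: s.
  - exact: rll.
  - by rewrite (alg_homB f0_hom) (alg_homM f0_hom) f0L f0_gen /= (yv s i).1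
      (alg_hom1 f0_hom) subrr.
  - by rewrite (alg_homB f0_hom) (alg_homM f0_hom) f0L f0_gen /= (yv s i).2
      (alg_hom1 f0_hom) subrr.
have [f1_hom f1E] := quot_lift_alg_hom f0_hom f0U.
set f1 := quot_lift f0 in f1_hom f1E.
have f1L s i j : f1 (UR_L R s i j) = y s i j by rewrite mxE f1E.
have f1T x : @tU_relator K X n q x -> f1 x = 0.
  case=> {x} [s x|s i XB i_n].
    apply/(orth_eqsP q0 s f1_hom): x => i k; rewrite -(yo s).
    by apply: eq_bigr => j _; rewrite !f1L.
  by rewrite (alg_homB f1_hom) f1L ym // (alg_hom1 f1_hom) subrr.
have [f2_hom f2E] := quot_lift_alg_hom f1_hom f1T.
exists (quot_lift f1); split=> // [s i j|s i].
  by rewrite mxE f2E f1L.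
by rewrite /tU_inv f2E /UR_inv f1E f0_gen.
Qed.

End UniversalProperty.

(** * The central elements z_i *)

Lemma pzscalar_mulI (K : fieldType) (A : pzAlgType K) (k : K) (x y : A) :
  k != 0 -> pzscalar k * x = pzscalar k * y -> x = y.
Proof.
move=> k0 /(congr1 (fun u => pzscalar k^-1 * u)).
by rewrite !mulrA -!pzscalarM mulVf // pzscalar1 !mul1r.
Qed.

(** Moving x past m and past p produces reciprocal factors, which cancel for the product p m. *)
Lemma qcomm_mul (K : fieldType) (A : pzAlgType K) (c c' : K) (p m x : A) : c' != 0 ->
  pzscalar c * (x * m) = pzscalar c' * (m * x) ->
  pzscalar c * (p * x) = pzscalar c' * (x * p) -> p * m * x = x * (p * m).
Proof.
move=> c0 em ep; apply: (pzscalar_mulI c0).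
by rewrite -mulrA -pzscalarCA -em pzscalarCA [p * (x * m)]mulrA mulrA ep -!mulrA.
Qed.

Section DiagonalCommutation.
Variables (K : fieldType) (X : cartan_type) (n : nat) (q : K).
Local Notation N := (rdim X n).
Local Notation R := (Rq X n q).
Local Notation r i k j l := (R (mxtens_index (i, k)) (mxtens_index (j, l))).
Variable d : 'I_N -> 'I_N -> K.
Hypothesis R_tri : triangular (@eps X n) d R.
Variables (B : pzAlgType K) (y y' : 'I_N -> 'I_N -> B).
Hypothesis rll : RLL_eqs q y y'.

(* In the ((k, i), (l, i)) entry of the relation, triangularity of R and of y'
   leaves only the diagonal coefficients of R. *)
Lemma RLL_upper_diag i k l : (forall a b : 'I_N, ~~ (a <= b)%N -> y' a b = 0) ->
  pzscalar (d k i) * (y k l * y' i i) = pzscalar (d l i) * (y' i i * y k l).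
Proof.
move=> y'0; have [Rd Roff] := R_tri; have := rll k i l i.
rewrite (bigD1 k) //= [X in _ + X = _]big1 ?addr0 => [|a ak]; last first.
  rewrite big1 // => b _; have [->|/Roff[[ka _]|[_ ib _]]] := eqVneq (r k i a b) 0.
  - by rewrite pzscalar0 mul0r.
  - by rewrite ka eqxx in ak.
  - by rewrite y'0 ?mulr0 // -ltnNge.
rewrite (bigD1 i) //= [X in _ + X = _]big1 ?addr0 => [|b bi]; last first.
  have [->|/Roff[[_ ib]|[_ ib _]]] := eqVneq (r k i k b) 0.
  - by rewrite pzscalar0 mul0r.
  - by rewrite ib eqxx in bi.
  - by rewrite y'0 ?mulr0 // -ltnNge.
rewrite [RHS](bigD1 l) //= [X in _ = _ + X]big1 ?addr0 => [|a al]; last first.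
  rewrite big1 // => b _; have [->|/Roff[[ka _]|[_ ib _]]] := eqVneq (r a b l i) 0.
  - by rewrite pzscalar0 mulr0.
  - by rewrite ka eqxx in al.
  - by rewrite y'0 ?mul0r // -ltnNge.
rewrite [RHS](bigD1 i) //= [X in _ = _ + X]big1 ?addr0 => [|b bi]; last first.
  have [->|/Roff[[_ ib]|[_ ib _]]] := eqVneq (r l b l i) 0.
  - by rewrite pzscalar0 mulr0.
  - by rewrite ib eqxx in bi.
  - by rewrite y'0 ?mul0r // -ltnNge.
by rewrite !Rd -pzscalar_comm.
Qed.

(** The mirror image, from the ((i, k), (i, l)) entry: a strictly triangular coefficient of R comes
    with some y a i, a < i, on the left or y i a, i < a, on the right, and both vanish. *)
Lemma RLL_lower_diag i k l : (forall a b : 'I_N, ~~ (b <= a)%N -> y a b = 0) ->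
  pzscalar (d i k) * (y i i * y' k l) = pzscalar (d i l) * (y' k l * y i i).
Proof.
move=> y0; have [Rd Roff] := R_tri; have := rll i k i l.
rewrite (bigD1 i) //= [X in _ + X = _]big1 ?addr0 => [|a ai]; last first.
  rewrite big1 // => b _; have [->|/Roff[[ia _]|[ai' _ _]]] := eqVneq (r i k a b) 0.
  - by rewrite pzscalar0 mul0r.
  - by rewrite ia eqxx in ai.
  - by rewrite y0 ?mul0r ?mulr0 // -ltnNge.
rewrite (bigD1 k) //= [X in _ + X = _]big1 ?addr0 => [|b bk]; last first.
  have [->|/Roff[[_ ib]|[ii _ _]]] := eqVneq (r i k i b) 0.
  - by rewrite pzscalar0 mul0r.
  - by rewrite ib eqxx in bk.
  - by rewrite ltnn in ii.
rewrite [RHS](bigD1 i) //= [X in _ = _ + X]big1 ?addr0 => [|a ai]; last first.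
  rewrite big1 // => b _; have [->|/Roff[[ia _]|[ai' _ _]]] := eqVneq (r a b i l) 0.
  - by rewrite pzscalar0 mulr0.
  - by rewrite ia eqxx in ai.
  - by rewrite y0 ?mulr0 ?mul0r // -ltnNge.
rewrite [RHS](bigD1 l) //= [X in _ = _ + X]big1 ?addr0 => [|b bl]; last first.
  have [->|/Roff[[_ ib]|[ii _ _]]] := eqVneq (r i b i l) 0.
  - by rewrite pzscalar0 mulr0.
  - by rewrite ib eqxx in bl.
  - by rewrite ltnn in ii.
by rewrite !Rd -pzscalar_comm.
Qed.

End DiagonalCommutation.

Lemma commr_inverse (A : pzRingType) (z a b : A) :
  GRing.comm z a -> a * b = 1 -> b * a = 1 -> GRing.comm z b.
Proof.
move=> za ab ba; rewrite /GRing.comm.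
by rewrite -[LHS]mul1r -ba -mulrA [a * _]mulrA -za -mulrA ab mulr1.
Qed.

(** Meant for z_i z_i': centrality of a b lets c pass to the front, where c a and then b d
    collapse. *)
Lemma mulr_quad (A : pzRingType) (a b c d : A) :
  GRing.comm (a * b) c -> c * a = 1 -> b * d = 1 -> a * b * (c * d) = 1.
Proof.
by move=> abc ca bd; rewrite mulrA abc [c * _]mulrA ca mul1r.
Qed.

Section CentralElements.
Variables (K : fieldType) (X : cartan_type) (n : nat) (q : K).
Hypothesis q0 : q != 0.
Local Notation N := (rdim X n).
Local Notation C := (Cq X n q).
Local Notation U := (tU X n q).
Local Notation y := (@tU_L K X n q).
Local Notation v := (@tU_inv K X n q).

Definition zdiag (i : 'I_N) : U := y true i i * y false i i.

(** Each factor of z_i commutes with l_kl up to a scalar. The mixed relation serves both cases of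
    opposite signs, because it has L^+ in the first leg and L^- in the second. *)
Lemma zdiag_comm_L i s k l : zdiag i * y s k l = y s k l * zdiag i.
Proof.
have [d [dC d0 Rtri]] := Rq_triangular n X q0.
have [y0 [rpp rmm rpm] _ _ _] := tU_eqs_tU X n q0.
have lo (a b : 'I_N) : ~~ (b <= a)%N -> y true a b = 0 by move=> h; apply: y0.
have up (a b : 'I_N) : ~~ (a <= b)%N -> y false a b = 0 by move=> h; apply: y0.
have em : pzscalar (d k i) * (y s k l * y false i i) =
          pzscalar (d l i) * (y false i i * y s k l).
  by case: (s); [apply: (RLL_upper_diag Rtri rpm)|apply: (RLL_upper_diag Rtri rmm)].
have ep : pzscalar (d i k) * (y true i i * y s k l) =
          pzscalar (d i l) * (y s k l * y true i i).
  by case: (s); [apply: (RLL_lower_diag Rtri rpp)|apply: (RLL_lower_diag Rtri rpm)].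
(* Symmetry of d puts the same two coefficients, d i k and d i l, into both relations. *)
rewrite (dC k) (dC l) in em.
exact: qcomm_mul (d0 i l) em ep.
Qed.

Lemma zdiag_central i x : GRing.comm (zdiag i) x.
Proof.
have [_ _ yv _ _] := tU_eqs_tU X n q0.
move: x; apply: tU_ind => [x x' e e'|k|s k l x e|s k x e].
- exact: commrD.
- by rewrite /GRing.comm pzscalar_comm.
- by apply: commrM e; apply: zdiag_comm_L.
- have [yv1 vy1] := yv s k; apply: commrM e.
  exact: commr_inverse (zdiag_comm_L i s k k) yv1 vy1.
Qed.

Lemma Cq_diag_neq0 i : C i i != 0.
Proof.
have := Cq_unit X n q0; rewrite unitmxE det_diag unitfE => /prodf_neq0/(_ i isT).
by rewrite !mxE eqxx mulr1n.
Qed.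

(** In the (i, i) entry of L C L^t' = C only j = i survives: i |-> i' reverses the order, so for j
    != i one of l_ij, l_i'j' lies outside the triangle. *)
Lemma tU_L_rev s i : y s i i * y s (rev_ord i) (rev_ord i) = 1.
Proof.
have [y0 _ _ yo _] := tU_eqs_tU X n q0; apply: (pzscalar_mulI (Cq_diag_neq0 i)).
rewrite mulr1 -[RHS](yo s i i) (bigD1 i) //= big1 ?addr0 => [|j ji].
  by rewrite mulrA -pzscalar_comm.
have [h|h] : ~~ ell_support (s, i, j) \/ ~~ ell_support (s, rev_ord i, rev_ord j).
  have := ltn_ord i; have := ltn_ord j; move: ji; rewrite -val_eqE /=.
  by case: (s); lia.
  by rewrite y0 // !mul0r.
by rewrite (y0 _ _ _ h) mulr0.
Qed.

Lemma zdiag_rev i : zdiag i * zdiag (rev_ord i) = 1.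
Proof.
apply: mulr_quad; [exact: zdiag_central | | exact: tU_L_rev].
by have := tU_L_rev true (rev_ord i); rewrite rev_ordK.
Qed.

Lemma zdiag_mid (i : 'I_N) : X = TypeB -> i = n :> nat -> zdiag i = 1.
Proof.
move=> XB i_n; have [_ _ _ _ ym] := tU_eqs_tU X n q0.
by rewrite /zdiag !ym // mulr1.
Qed.

End CentralElements.

(** * The powers z^(m/4) *)

Section QuarterPower.
Variable A : pzRingType.
Implicit Types (c x : A) (m : int).

(** The argument c' plays the inverse of c; [Negz k] is -(k+1), whence the exponent k.+1. *)
Definition int_pow c c' m : A :=
  match m with Posz k => c ^+ k | Negz k => c' ^+ k.+1 end.

Lemma int_powS c c' m : c' * c = 1 -> int_pow c c' (m + 1) = int_pow c c' m * c.
Proof.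
move=> c'c; case: m => [k|[|k]]; first by rewrite -PoszD addn1 /= exprSr.
  by rewrite /= expr1 c'c.
rewrite (_ : Negz k.+1 + 1 = Negz k); last by rewrite !NegzE; lia.
by rewrite /= [c' ^+ k.+2]exprSr -mulrA c'c mulr1.
Qed.

Definition quarter_pow c c' m : A :=
  if (4 %| m)%Z then int_pow c c' (m %/ 4)%Z else 0.

(** A shift by 4 preserves divisibility by 4, so the value 0 off the multiples of 4 is consistent
    with the rule. *)
Lemma quarter_powD4 c c' m : c' * c = 1 ->
  quarter_pow c c' (m + 4) = quarter_pow c c' m * c.
Proof.
move=> c'c; rewrite /quarter_pow (_ : (4 %| m + 4)%Z = (4 %| m)%Z); last by lia.
case: ifP => _; last by rewrite mul0r.
by rewrite (_ : ((m + 4) %/ 4)%Z = (m %/ 4)%Z + 1) ?int_powS //; lia.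
Qed.

Lemma quarter_powB4 c c' m : c * c' = 1 -> c' * c = 1 ->
  quarter_pow c c' (m - 4) = quarter_pow c c' m * c'.
Proof.
move=> cc' c'c.
by rewrite -[m in RHS](subrK 4) quarter_powD4 // -mulrA cc' mulr1.
Qed.

Lemma prod_centralM (I : Type) (r : seq I) (F G : I -> A) :
  (forall i x, GRing.comm (G i) x) ->
  \prod_(i <- r) (F i * G i) = (\prod_(i <- r) F i) * \prod_(i <- r) G i.
Proof.
move=> cG; elim: r => [|i r IH]; first by rewrite !big_nil mulr1.
rewrite !big_cons IH -!mulrA; congr (_ * _).
by rewrite mulrA cG -mulrA.
Qed.

End QuarterPower.

Lemma leq_rdim X n : (n <= rdim X n)%N. Proof. by case: X => /=; lia. Qed.

Section WeightPower.
Variables (K : fieldType) (X : cartan_type) (n : nat) (q : K).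
Hypothesis q0 : q != 0.
Local Notation N := (rdim X n).
Local Notation U := (tU X n q).
Local Notation z := (@zdiag K X n q).

Definition first_half (k : 'I_n) : 'I_N := widen_ord (leq_rdim X n) k.

(* z^(m/4), read as 0 unless 4 divides m. *)
Definition weight_pow (m : 'rV[int]_n) : U :=
  \prod_(k < n) quarter_pow (z (first_half k)) (z (rev_ord (first_half k))) (m 0 k).

Lemma weight_pow0 : weight_pow 0 = 1.
Proof. by rewrite /weight_pow big1 // => k _; rewrite mxE. Qed.

Lemma zdiag_revV i : z (rev_ord i) * z i = 1.
Proof. by have := zdiag_rev q0 (rev_ord i); rewrite rev_ordK. Qed.

(** Adding 4 eps_i changes at most one coordinate, by 4 if i is in the first half and by -4 if i'
    is. The latter also yields z_i, as the inverse of z_i'. *)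
Lemma weight_powD4 m i : weight_pow (m + eps i *+ 4) = weight_pow m * z i.
Proof.
(* The coordinates where eps_i is nonzero: exactly one, or none for the middle index of type B,
   where z_i = 1. *)
pose S := [pred k : 'I_n | (i == k :> nat) || (rev_ord i == k :> nat)].
have hN : N = n.*2 \/ X = TypeB /\ N = n.*2.+1 by case: (X) => /=; auto.
have ri := ltn_ord i; have rev_i : rev_ord i = (N - i.+1)%N :> nat by [].
have zS : \prod_(k < n) (if S k then z i else 1) = z i.
  rewrite -big_mkcond /=.
  have one (k0 : 'I_n) : S k0 -> \prod_(k | S k) z i = z i.
    move=> Sk0; rewrite (eq_bigl (pred1 k0)) ?big_pred1_eq // => k /=.
    have := ltn_ord k; have := ltn_ord k0; move: Sk0; rewrite /= -val_eqE /= => *; lia.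
  have [i_n|n_i] := ltnP i n.
    by apply: (one (Ordinal i_n)); rewrite /= eqxx.
  have [i_n'|n_i'] := ltnP (rev_ord i) n.
    by apply: (one (Ordinal i_n')); rewrite /= eqxx orbT.
  have [XB i_n] : X = TypeB /\ i = n :> nat.
    by case: hN => [hN|[XB hN]]; [lia | split=> //; lia].
  by rewrite zdiag_mid // big1.
rewrite -[z i in RHS]zS -prod_centralM => [|k x]; last first.
  by case: ifP => _; [apply: zdiag_central | apply: commr_sym; apply: commr1].
apply: eq_bigr => k _; have kn := ltn_ord k.
rewrite mxE mulmxnE mxE /=; case: (i =P k :> nat) => [ik|ik].
  have -> : first_half k = i by apply: val_inj.
  have /negPf-> : (N - i.+1)%N != k by lia.
  by rewrite subr0 quarter_powD4 // zdiag_revV.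
case: ((N - i.+1)%N =P k :> nat) => [ik'|ik'].
  (* Here coordinate k decreases by 4, which multiplies by the inverse of z_i', that is, by z_i. *)
  have -> : first_half k = rev_ord i by apply: val_inj.
  by rewrite sub0r mulNrn quarter_powB4 ?rev_ordK ?zdiag_rev ?zdiag_revV.
by rewrite subrr mul0rn addr0 mulr1.
Qed.

End WeightPower.

(** * Twisting by weights *)

Section Twist.
Variables (K : fieldType) (X : cartan_type) (n : nat) (q : K).
Hypothesis q0 : q != 0.
Local Notation N := (rdim X n).
Local Notation R := (Rq X n q).
Local Notation C := (Cq X n q).
Local Notation U := (tU X n q).
Local Notation L := (laurent K n).
Local Notation lm := (laurent_monomial K).

Section TwistEqs.
(** An abstract stand-in for a, mu |-> a (x) L_mu. *)
Variables (B T : pzAlgType K) (pure : B -> 'rV[int]_n -> T).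
Hypothesis pureB : forall mu, zmod_morphism (pure^~ mu).
Hypothesis pureZ : forall k a mu, pure (pzscalar k * a) mu = pzscalar k * pure a mu.
Hypothesis pureM : forall a b mu nu, pure a mu * pure b nu = pure (a * b) (mu + nu).
Hypothesis pure1 : pure 1 0 = 1.

Let pure0 mu : pure 0 mu = 0. Proof. exact: zmod_morphism0 (pureB mu). Qed.

Let pure_sum (I : Type) (r : seq I) (P : pred I) (F : I -> B) mu :
  \sum_(i <- r | P i) pure (F i) mu = pure (\sum_(i <- r | P i) F i) mu.
Proof. by rewrite (zmod_morphism_sum (pureB mu)). Qed.

Lemma Rq_weight i k j l : R (mxtens_index (i, k)) (mxtens_index (j, l)) != 0 ->
  eps i + eps k = eps j + eps l.
Proof.
have [d [_ _ [_ Roff]]] := Rq_triangular n X q0.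
by move=> /Roff[[-> ->]|[]].
Qed.

Lemma eps_mid (i : 'I_N) : X = TypeB -> i = n :> nat -> eps i = 0.
Proof.
move=> XB i_n; have /eqP ri : rev_ord i == i.
  by rewrite rev_ord_fixed; case: (X) XB i i_n => // _ i /eqP.
by apply/rowP=> k; rewrite !mxE ri subrr.
Qed.

Definition twist (y : bool -> 'I_N -> 'I_N -> B) s i j : T :=
  pure (y s i j) (- eps i - eps j).

(** The weight is opposite to that of the twisted l_ii, namely -2 eps_i. *)
Definition twist_inv (v : bool -> 'I_N -> B) s i : T :=
  pure (v s i) (eps i + eps i).

Lemma twistM y s s' i j k l : twist y s i j * twist y s' k l =
  pure (y s i j * y s' k l) (- (eps i + eps k) - (eps j + eps l)).
Proof.
by rewrite /twist pureM !opprD addrACA.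
Qed.

(** Weights have to agree only where the coefficient is nonzero; this is how weight preservation of
    R enters. *)
Lemma pure_scal_congr k a b mu nu : (k != 0 -> mu = nu) -> a = b ->
  pzscalar k * pure a mu = pure (pzscalar k * b) nu.
Proof.
move=> h ->; have [->|/h->] := eqVneq k 0; last by rewrite -pureZ.
by rewrite -pureZ pzscalar0 mul0r !pure0.
Qed.

Lemma tU_eqs_twist y v : tU_eqs q y v -> tU_eqs q (twist y) (twist_inv v).
Proof.
move=> [y0 [r1 r2 r3] yv yo ym].
have rll s s' : RLL_eqs q (y s) (y s') -> RLL_eqs q (twist y s) (twist y s').
  (* All terms with nonzero coefficient, on either side, have this weight, so the twisted relation
     is the original one placed in weight mu. *)
  move=> e i k j l; set mu := - (eps i + eps k) - (eps j + eps l).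
  transitivity (pure (\sum_a \sum_b pzscalar (R (mxtens_index (i, k)) (mxtens_index (a, b)))
      * (y s a j * y s' b l)) mu).
    rewrite -pure_sum; apply: eq_bigr => a _; rewrite -pure_sum; apply: eq_bigr => b _.
    rewrite twistM; apply: pure_scal_congr => // /Rq_weight w.
    by rewrite /mu w.
  rewrite e -pure_sum; apply: eq_bigr => a _; rewrite -pure_sum; apply: eq_bigr => b _.
  rewrite twistM -!pzscalar_comm; apply/esym/pure_scal_congr => // /Rq_weight w.
  by rewrite /mu -w [eps b + _]addrC [eps k + _]addrC.
split.
- by move=> s i j h; rewrite /twist y0 // pure0.
- by split; apply: rll.
- move=> s i; have [yv1 vy1] := yv s i.
  rewrite /twist /twist_inv !pureM yv1 vy1 -opprD addNr subrr.
  by rewrite pure1.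
- move=> s i k.
  (* The contributions of j and j' cancel, so the weight does not depend on j; it is 0 for i = k,
     and otherwise the right-hand side vanishes. *)
  transitivity (pure (\sum_j pzscalar (C j j) * (y s i j * y s (rev_ord k) (rev_ord j)))
      (- eps i + eps k)).
    rewrite -pure_sum; apply: eq_bigr => j _.
    rewrite -pzscalar_comm -mulrA twistM; apply: pure_scal_congr => // _.
    by rewrite !eps_rev subrr subr0 opprB addrC.
  rewrite (eq_bigr (fun j => y s i j * pzscalar (C j j) * y s (rev_ord k) (rev_ord j))).
    rewrite yo; have [->|ik] := eqVneq i k.
      by rewrite addNr -[pzscalar _]mulr1 pureZ pure1 mulr1.
    by rewrite Cq_offdiag // !pzscalar0 pure0.
  by move=> j _; rewrite mulrA pzscalar_comm.
- move=> s i XB i_n; rewrite /twist ym // eps_mid // oppr0 addr0.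
  exact: pure1.
Qed.

End TwistEqs.

(** Used with f the identity for delta and with f the projection to U~' for eta_R. *)
Lemma twist_hom (A : pzAlgType K) (f : U -> A) : alg_hom f ->
  exists g : U -> tensor A L, [/\ alg_hom g,
    forall s i j, g (tU_L X n q s i j) =
      pure_tensor (f (tU_L X n q s i j)) (lm (- eps i - eps j))
    & forall s i, g (tU_inv q s i) = pure_tensor (f (tU_inv q s i)) (lm (eps i + eps i))].
Proof.
move=> hf; pose pure (a : A) (mu : 'rV[int]_n) : tensor A L := pure_tensor a (lm mu).
have e : tU_eqs q (twist pure (fun s i j => f (tU_L X n q s i j)))
    (twist_inv pure (fun s i => f (tU_inv q s i))).
  apply: tU_eqs_twist.
  - by move=> mu; apply: pure_tensor_zmodl.
  - by move=> k a mu; apply: pure_tensorZl.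
  - by move=> a b mu nu; rewrite /pure pure_tensorM laurent_monomialD.
  - by rewrite /pure laurent_monomial0 pure_tensor1.
  - exact: tU_eqs_alg_hom hf (tU_eqs_tU X n q0).
by have [g [hg gL gv]] := tU_universal q0 e; exists g.
Qed.

End Twist.

(** * Injectivity *)

Lemma mulr_commA (A : pzRingType) (a b c : A) : GRing.comm b c -> a * b * c = a * (c * b).
Proof. by move=> bc; rewrite -mulrA bc. Qed.

(** A relator b - b w with w central keeps this form under multiplication from both sides. *)
Lemma central_absorb (A : pzRingType) (a b c w : A) : (forall x, GRing.comm w x) ->
  a * (b - b * w) * c = a * b * c - a * b * c * w.
Proof. by move=> cw; rewrite mulrBr mulrBl mulrA -[a * b * w * c]mulrA cw mulrA. Qed.

Section ZmodMorphismMul.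
Variables (A B : pzRingType) (f : A -> B).
Hypothesis fB : zmod_morphism f.

Lemma zmod_morphism_mullD c d x y :
  f (c * x) = d * f x -> f (c * y) = d * f y -> f (c * (x + y)) = d * f (x + y).
Proof. by move=> ex ey; rewrite mulrDr !(zmod_morphismD fB) ex ey mulrDr. Qed.

Lemma zmod_morphism_fixD c x y :
  f (x * c) = f x -> f (y * c) = f y -> f ((x + y) * c) = f (x + y).
Proof. by move=> ex ey; rewrite mulrDl !(zmod_morphismD fB) ex ey. Qed.

End ZmodMorphismMul.

Section LaurentTensor.
Variables (K : fieldType) (A : pzAlgType K) (n : nat).
Local Notation L := (laurent K n).
Local Notation lm := (laurent_monomial K).
Local Notation pure := (@pure_tensor K A L).

Lemma lin_ext_laurent (V : pzAlgType K) h (nu : 'rV[int]_n) :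
  lin_ext h (lm nu) = h nu :> V.
Proof. exact: lin_ext_basis. Qed.

Lemma pure_monomialM a b mu nu :
  pure a (lm mu) * pure b (lm nu) = pure (a * b) (lm (mu + nu)).
Proof. by rewrite pure_tensorM laurent_monomialD. Qed.

(** Monomials span the Laurent factor, and their coefficients move into A. *)
Lemma tensor_laurent_ind (P : tensor A L -> Prop) :
  (forall x y, P x -> P y -> P (x + y)) -> (forall a nu, P (pure a (lm nu))) ->
  forall x, P x.
Proof.
move=> PD Pp; apply: tensor_ind => // a g.
elim/monoid_alg_ind: g => [|g g' Pg Pg'|c m].
- have -> : pure a 0 = pure 0 (lm 0).
    rewrite (zmod_morphism0 (pure_tensor_zmodl _)).
    exact: (zmod_morphism0 (pure_tensor_zmodr _)).
  exact: Pp.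
- by rewrite pure_tensorDr; apply: PD.
have -> : pure a << c *g m >> = pure (pzscalar c * a) (lm m).
  by rewrite monalgU_scalar pure_tensorZr pure_tensorZl.
exact: Pp.
Qed.

Lemma pure_tensor_central a nu : (forall b, GRing.comm a b) ->
  forall x, GRing.comm (pure a (lm nu)) x.
Proof.
move=> ca; apply: tensor_laurent_ind => [x y|b mu]; first exact: commrD.
apply: etrans (pure_monomialM _ _ _ _) (etrans _ (esym (pure_monomialM _ _ _ _))).
by rewrite ca addrC.
Qed.

End LaurentTensor.

Section Projection.
Variables (K : fieldType) (X : cartan_type) (n : nat) (q : K).
Hypothesis q0 : q != 0.
Local Notation N := (rdim X n).
Local Notation U := (tU X n q).
Local Notation U' := (tU' X n q).
Local Notation L := (laurent K n).
Local Notation lm := (laurent_monomial K).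
Local Notation z := (@zdiag K X n q).
Local Notation y := (@tU_L K X n q).
Local Notation v := (@tU_inv K X n q).
Local Notation pi := (to_quot (@tU'_relator K X n q)).

Definition weight_ext (mu : 'rV[int]_n) : L -> U :=
  lin_ext (fun nu : Algebra.to_multiplicative 'rV[int]_n =>
    @weight_pow K X n q (mu + (nu : 'rV[int]_n))).

Definition weight_proj (mu : 'rV[int]_n) : tensor U L -> U :=
  tensor_lift (fun a g => a * weight_ext mu g).

Lemma weight_proj_beta mu :
  [/\ forall a a' g, (a + a') * weight_ext mu g = a * weight_ext mu g + a' * weight_ext mu g,
      forall a g g', a * weight_ext mu (g + g') = a * weight_ext mu g + a * weight_ext mu g',
      forall k a g, pzscalar k * a * weight_ext mu g = pzscalar k * (a * weight_ext mu g)
    & forall k a g, a * weight_ext mu (pzscalar k * g) = pzscalar k * (a * weight_ext mu g)].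
Proof.
split=> *; [exact: mulrDl | | by rewrite mulrA |].
  by rewrite -mulrDr -(zmod_morphismD (lin_ext_zmod _)).
by rewrite -pzscalarCA -(lin_extZ _).
Qed.

Lemma weight_proj_zmod mu : zmod_morphism (weight_proj mu).
Proof.
case: (weight_proj_beta mu) => b1 b2 b3 b4.
exact: (tensor_lift_zmod b1 b2 b3 b4).
Qed.

Lemma weight_proj_pure mu a nu :
  weight_proj mu (pure_tensor a (lm nu)) = a * @weight_pow K X n q (mu + nu).
Proof.
case: (weight_proj_beta mu) => b1 b2 b3 b4.
apply: etrans (tensor_lift_pure b1 b2 b3 b4 _ _) _.
by rewrite /weight_ext lin_ext_laurent.
Qed.

Lemma weight_projZ mu k x : weight_proj mu (pzscalar k * x) = pzscalar k * weight_proj mu x.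
Proof.
move: x; apply: tensor_laurent_ind => [x x' e e'|a nu].
  exact: (zmod_morphism_mullD (weight_proj_zmod mu) e e').
rewrite weight_proj_pure; apply: etrans (congr1 _ (esym (pure_tensorZl _ _ _))) _.
by rewrite weight_proj_pure mulrA.
Qed.

(** This is the image of z_i under the grading delta, as both factors of z_i have weight -2
    eps_i. *)
Definition zdiag_shift (i : 'I_N) : tensor U L := pure_tensor (z i) (lm (- (eps i *+ 4))).

Lemma zdiag_shift_central i x : GRing.comm (zdiag_shift i) x.
Proof. by apply: pure_tensor_central => b; apply: zdiag_central. Qed.

(** The extra z_i makes up for the loss of 4 eps_i in the exponent. *)
Lemma weight_proj_shift mu i x : weight_proj mu (x * zdiag_shift i) = weight_proj mu x.
Proof.
move: x; apply: tensor_laurent_ind => [x x' e e'|a nu].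
  exact: (zmod_morphism_fixD (weight_proj_zmod mu) e e').
transitivity (weight_proj mu (pure_tensor (a * z i) (lm (nu - eps i *+ 4)))).
  by congr (weight_proj _ _); apply: pure_monomialM.
apply: etrans (weight_proj_pure _ _ _) (etrans _ (esym (weight_proj_pure _ _ _))).
have -> : mu + nu = mu + (nu - eps i *+ 4) + eps i *+ 4.
  by rewrite -addrA subrK.
rewrite weight_powD4 //; apply: mulr_commA; exact: zdiag_central.
Qed.

(** Cancelling l_ii^s in z_i is immediate for s = +; for s = - the factors stand in the other order
    and centrality is used. Thus the relators of U~' are v (1 - z_i), with v the inverse of
    l_ii^s. *)
Lemma zdiag_inv s i : y (~~ s) i i = v s i * z i.
Proof.
have [_ _ yv _ _] := tU_eqs_tU X n q0; have [_ vy] := yv s i.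
have [e|e] : z i = y s i i * y (~~ s) i i \/ v s i * z i = y (~~ s) i i * y s i i * v s i.
- by case: s {yv vy} => /=; [left | right; apply: esym; apply: zdiag_central].
- by rewrite e mulrA vy mul1r.
by rewrite e -mulrA (yv s i).1 mulr1.
Qed.

Section Kernel.
Variable delta : U -> tensor U L.
Hypothesis delta_hom : alg_hom delta.
Hypothesis deltaL : forall s i j,
  delta (y s i j) = pure_tensor (y s i j) (lm (- eps i - eps j)).
Hypothesis deltav : forall s i,
  delta (v s i) = pure_tensor (v s i) (lm (eps i + eps i)).

Lemma delta_relator s i : delta (v s i - y (~~ s) i i) =
  delta (v s i) - delta (v s i) * zdiag_shift i.
Proof.
rewrite (alg_homB delta_hom); congr (_ - _).
rewrite deltaL deltav zdiag_inv; apply: esym; apply: etrans (pure_monomialM _ _ _ _) _.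
congr (pure_tensor _ (lm _)).
by rewrite -mulr2n -[4%N]/(2 + 2)%N mulrnDr opprD addrA subrr add0r mulr2n opprD.
Qed.

(** Multiplied on both sides, a relator is sent by delta to some c - c [zdiag_shift i], and the
    projection takes equal values on the two terms. *)
Lemma weight_proj_ideal mu x : gen_ideal (@tU'_relator K X n q) x ->
  weight_proj mu (delta x) = 0.
Proof.
have pB := weight_proj_zmod mu.
apply: (gen_ideal_zmod (f := weight_proj mu \o delta)) => [|_ a b [s i]].
  by move=> a b; rewrite /= (alg_homB delta_hom) pB.
rewrite /= !(alg_homM delta_hom) delta_relator central_absorb; last exact: zdiag_shift_central.
apply: etrans (pB _ _) _; apply/eqP; rewrite subr_eq0; apply/eqP/esym.
exact: weight_proj_shift.
Qed.

Definition weight_comp (mu : 'rV[int]_n) : U' -> U :=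
  quot_lift (weight_proj mu \o delta).

Let proj_zmod mu : zmod_morphism (weight_proj mu \o delta).
Proof. by move=> a b; rewrite /= (alg_homB delta_hom) weight_proj_zmod. Qed.

Lemma weight_compE mu x : weight_comp mu (pi x) = weight_proj mu (delta x).
Proof. exact: quot_liftE (proj_zmod mu) (weight_proj_ideal mu). Qed.

Lemma weight_comp_zmod mu : zmod_morphism (weight_comp mu).
Proof. exact: quot_lift_zmod (proj_zmod mu) (weight_proj_ideal mu). Qed.

Lemma weight_compZ mu k x : weight_comp mu (pzscalar k * x) = pzscalar k * weight_comp mu x.
Proof.
rewrite -[x]to_quot_repr -(alg_hom_scalar (to_quot_alg_hom _)) -to_quotM.
apply: etrans (weight_compE _ _) (etrans _ (congr1 _ (esym (weight_compE _ _)))).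
by rewrite (alg_homM delta_hom) (alg_hom_scalar delta_hom) weight_projZ.
Qed.

Definition untwist_form (a : U') : L -> U :=
  lin_ext (fun nu : Algebra.to_multiplicative 'rV[int]_n =>
    weight_comp (- (nu : 'rV[int]_n)) a).

Definition untwist : tensor U' L -> U := tensor_lift untwist_form.

Lemma untwist_form_bilinear :
  [/\ forall a a' g, untwist_form (a + a') g = untwist_form a g + untwist_form a' g,
      forall a g g', untwist_form a (g + g') = untwist_form a g + untwist_form a g',
      forall k a g, untwist_form (pzscalar k * a) g = pzscalar k * untwist_form a g
    & forall k a g, untwist_form a (pzscalar k * g) = pzscalar k * untwist_form a g].
Proof.
split=> [a a' g|a g g'|k a g|k a g].
- apply: etrans (lin_extDf _ _ _); apply: eq_lin_ext => m.
  exact: zmod_morphismD (weight_comp_zmod _) _ _.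
- exact: zmod_morphismD (lin_ext_zmod _) _ _.
- apply: etrans (lin_extZf _ _ _); apply: eq_lin_ext => m; exact: weight_compZ.
- exact: lin_extZ.
Qed.

Lemma untwist_pure a nu : untwist (pure_tensor a (lm nu)) = weight_comp (- nu) a.
Proof.
case: untwist_form_bilinear => b1 b2 b3 b4.
apply: etrans (tensor_lift_pure b1 b2 b3 b4 _ _) _.
by rewrite /untwist_form lin_ext_laurent.
Qed.

Lemma untwist_zmod : zmod_morphism untwist.
Proof.
case: untwist_form_bilinear => b1 b2 b3 b4; exact: (tensor_lift_zmod b1 b2 b3 b4).
Qed.

End Kernel.

(** [untwist] is a left inverse. By additivity this is checked on homogeneous elements, where eta
    and delta are both explicit. *)
Lemma twist_injective (eta : U -> tensor U' L) : alg_hom eta ->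
  (forall s i j, eta (y s i j) = pure_tensor (pi (y s i j)) (lm (- eps i - eps j))) ->
  (forall s i, eta (v s i) = pure_tensor (pi (v s i)) (lm (eps i + eps i))) ->
  injective eta.
Proof.
move=> eta_hom etaL etav.
have [delta [delta_hom deltaL deltav]] := twist_hom q0 (@alg_hom_id K U).
(* Homogeneity of weight nu, recorded for delta and eta at once. *)
pose hom x nu := delta x = pure_tensor x (lm nu) /\ eta x = pure_tensor (pi x) (lm nu).
have homM x x' nu nu' : hom x nu -> hom x' nu' -> hom (x * x') (nu + nu').
  move=> [dx ex] [dx' ex']; split.
    by rewrite (alg_homM delta_hom) dx dx'; apply: pure_monomialM.
  rewrite (alg_homM eta_hom) ex ex' to_quotM; exact: pure_monomialM.
have spanned (Q : U -> Prop) x : (forall a b, Q a -> Q b -> Q (a + b)) ->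
    (forall a nu, hom a nu -> Q a) -> Q x.
  (* Q varies in the induction: left multiplication by a generator g replaces it by a |-> Q (g
     a). *)
  move: x Q; apply: tU_ind => [x x' hx hx'|k|s i j x hx|s i x hx] Q QD Qh.
  - exact: QD (hx Q QD Qh) (hx' Q QD Qh).
  - apply: (Qh _ 0); split; rewrite laurent_monomial0.
      exact: etrans (alg_hom_scalar delta_hom k) (esym (pure_tensor_scalar _ _ k)).
    apply: etrans (alg_hom_scalar eta_hom k) (esym (pure_tensor_scalar _ _ k)).
  - apply: (hx (fun a => Q (y s i j * a))) => [a b Qa Qb|a nu ha].
      by rewrite mulrDr; apply: QD.
    by apply: (Qh _ (- eps i - eps j + nu)); apply: homM ha.
  - apply: (hx (fun a => Q (v s i * a))) => [a b Qa Qb|a nu ha].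
      by rewrite mulrDr; apply: QD.
    by apply: (Qh _ (eps i + eps i + nu)); apply: homM ha.
apply: (can_inj (g := untwist delta)) => x.
have uB := untwist_zmod delta_hom deltaL deltav.
apply: (spanned (fun x => untwist delta (eta x) = x)) => [a b ea eb|a nu [da ea]].
  by rewrite (alg_homD eta_hom) (zmod_morphismD uB) ea eb.
rewrite ea (untwist_pure delta_hom deltaL deltav).
rewrite (weight_compE delta_hom deltaL deltav) da weight_proj_pure.
(* The weight nu of a meets the index -nu of the projection, so z occurs with exponent 0. *)
by rewrite addNr weight_pow0 mulr1.
Qed.

End Projection.

Theorem proposition6p24 (K : closedFieldType) (q : K)
    (q_transcendental : transcendental q)
    (X : cartan_type) (n : nat) (n_ok : rank_ok X n) :
  exists! eta_R : tU X n q -> tensor (tU' X n q) (laurent K n),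
    [/\ alg_hom eta_R,
        injective eta_R
      & forall (s : bool) (i j : 'I_(rdim X n)),
          eta_R (tU_L X n q s i j) =
            pure_tensor (tU'_L X n q s i j)
              (laurent_monomial K (- eps i - eps j))].
Proof.
have q0 : q != 0.
  (* If q were 0, it would be a root of the nonzero integer polynomial X. *)
  apply: contraL isT => /eqP q0; have := q_transcendental 'X.
  by rewrite map_polyX polyX_eq0 => /(_ isT); rewrite /root hornerX q0 eqxx.
have [eta [eta_hom etaL etav]] :=
  twist_hom q0 (to_quot_alg_hom (@tU'_relator K X n q)).
have etaL' s i j : eta (tU_L X n q s i j) =
    pure_tensor (tU'_L X n q s i j) (laurent_monomial K (- eps i - eps j)).
  by rewrite etaL [tU'_L _ _ _ _ _ _]mxE.
exists eta; split.
  by split=> //; apply: (twist_injective q0 eta_hom etaL etav).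
(* Uniqueness: the values on the l_ij determine a homomorphism, those on the inverses being
   forced. *)
move=> eta' [eta'_hom _ eta'L]; apply: (tU_hom_ext q0 eta_hom eta'_hom) => s i j.
by rewrite etaL' eta'L.
Qed.
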